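(* There is no metrizable topology on $\mathcal{MR}$ that turns it into a complete topological algebra.
   Context: $\mathcal{MR}$ is the algebra over $\mathbb{C}$ of all meromorphic functions on $\mathbb{C}$ (the constant $\infty$ is not a meromorphic function), with pointwise operations. A topological algebra is an algebra with a topology that makes it a topological vector space and for which multiplication is (jointly) continuous; it is a complete topological algebra if it is complete as a topological vector space. *)

(* Defs.v *)
From HB Require Import structures.
From mathcomp Require Import all_boot all_order all_algebra.
From mathcomp Require Import generic_quotient ring_quotient.
From mathcomp Require Import complex.
From mathcomp Require Import all_classical all_reals all_analysis.

Set Implicit Arguments.
Unset Strict Implicit.
Unset Printing Implicit Defensive.

Import Order.TTheory GRing.Theory Num.Theory.
Import numFieldNormedType.Exports.

Local Open Scope classical_set_scope.
Local Open Scope ring_scope.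

Section MeromorphicFunctions.
(* Used with C := R[i]; its topology is the one of the norm. *)
Variable C : numFieldType.

(* [derivable g z 1] over the field R[i] is complex differentiability at z. *)
Definition holomorphic_at (g : C -> C) (a : C) : Prop :=
  \forall z \near a, derivable g z 1.

(* f is holomorphic on a punctured neighbourhood of a, where it has a removable
   singularity or a pole of order at most n; the value of f at a is ignored. *)
Definition meromorphic_at (f : C -> C) (a : C) : Prop :=
  exists n (g : C -> C), holomorphic_at g a /\
    \forall z \near a^', (z - a) ^+ n * f z = g z.

Definition meromorphic : {pred C -> C} :=
  fun f => `[< forall a, meromorphic_at f a >].

Lemma meromorphic_subring : subring_closed meromorphic.
Proof.
split.
- apply/asboolP => a; exists 0%N, (cst 1); split.
    by rewrite /holomorphic_at; near=> z; exact: derivable_cst.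
  by near=> z; rewrite expr0 mul1r.
- move=> f1 f2 /asboolP mf1 /asboolP mf2; apply/asboolP => a.
  have [n1 [g1 [hg1 fg1]]] := mf1 a; have [n2 [g2 [hg2 fg2]]] := mf2 a.
  pose p n : C -> C := (id - cst a) ^+ n.
  have dp n z : derivable (p n) z 1.
    by apply/derivableX/derivableB; [exact: derivable_id|exact: derivable_cst].
  have pE n z : p n z = (z - a) ^+ n by rewrite /p exprfctE.
  exists (n1 + n2)%N, (p n2 * g1 - p n1 * g2); split.
    near=> z; apply: derivableB; apply: derivableM;
      [exact: dp|by near: z|exact: dp|by near: z].
  near=> z.
  have e1 : (z - a) ^+ n1 * f1 z = g1 z by near: z; exact: fg1.
  have e2 : (z - a) ^+ n2 * f2 z = g2 z by near: z; exact: fg2.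
  rewrite -[RHS]/(p n2 z * g1 z - p n1 z * g2 z) -[(f1 - f2) z]/(f1 z - f2 z).
  by rewrite !pE -e1 -e2 exprD mulrBr -!mulrA (mulrCA ((z - a) ^+ n1)).
- move=> f1 f2 /asboolP mf1 /asboolP mf2; apply/asboolP => a.
  have [n1 [g1 [hg1 fg1]]] := mf1 a; have [n2 [g2 [hg2 fg2]]] := mf2 a.
  exists (n1 + n2)%N, (g1 * g2); split.
    by near=> z; apply: derivableM; near: z.
  near=> z.
  have e1 : (z - a) ^+ n1 * f1 z = g1 z by near: z; exact: fg1.
  have e2 : (z - a) ^+ n2 * f2 z = g2 z by near: z; exact: fg2.
  by rewrite -[RHS]/(g1 z * g2 z) -[(f1 * f2) z]/(f1 z * f2 z)
    -e1 -e2 exprD mulrACA.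
Unshelve. all: by end_near.
Qed.

Lemma meromorphic_subsemimod : GRing.subsemimod_closed meromorphic.
Proof.
split.
  have [m1 mB _] := meromorphic_subring.
  have m0 : 0 \in meromorphic.
    by have := mB _ _ m1 m1; rewrite subrr.
  split=> // f g mf mg; have := mB _ _ mf (mB _ _ m0 mg).
  by rewrite sub0r opprK.
move=> c f /asboolP mf; apply/asboolP => a; have [n [g [hg fg]]] := mf a.
exists n, (c \*: g); split.
  by near=> z; apply: derivableZ; near: z.
near=> z.
have e : (z - a) ^+ n * f z = g z by near: z; exact: fg.
by rewrite -[RHS]/(c * g z) -[(c *: f) z]/(c * f z) -e mulrCA.
Unshelve. all: by end_near.
Qed.

Record merofun := MeroFun {
  merofun_val :> C -> C;
  merofun_valP : merofun_val \in meromorphic }.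

HB.instance Definition _ := [isSub for merofun_val].
HB.instance Definition _ := [Choice of merofun by <:].
HB.instance Definition _ := GRing.SubChoice_isSubComNzRing.Build
  (C -> C) meromorphic merofun meromorphic_subring.
HB.instance Definition _ := GRing.SubZmodule_isSubLmodule.Build
  C (C -> C) meromorphic merofun meromorphic_subsemimod.

(* The ideal of functions vanishing off a closed discrete set. *)
Definition negligible : {pred merofun} :=
  fun f => `[< forall a : C, \forall z \near a^', f z = 0 >].

Lemma negligible_ideal : idealr_closed negligible.
Proof.
split.
- by apply/asboolP => a; near=> z.
- apply/asboolP => /(_ 0) n1; have : \forall z \near (0 : C)^', False.
    by apply: filterS n1 => z /eqP; rewrite -[_ z]/(1 : C) oner_eq0.
  exact: filter_not_empty.
- move=> h f g /asboolP nf /asboolP ng; apply/asboolP => a; near=> z.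
  have f0 : f z = 0 by near: z; exact: nf.
  have g0 : g z = 0 by near: z; exact: ng.
  by rewrite -[LHS]/(h z * f z + g z) f0 g0 mulr0 addr0.
Unshelve. all: by end_near.
Qed.

HB.instance Definition _ := isIdealr.Build merofun negligible negligible_ideal.

(* Meromorphic functions as classes of functions agreeing off a closed discrete
   set: the class forgets the (junk) values at poles and removable singularities,
   and away from these its operations are the pointwise ones. *)
Definition MR : Type := {ideal_quot negligible}.

HB.instance Definition _ := GRing.ComNzRing.on MR.

Local Notation toMR := (\pi_MR%qT : merofun -> MR).

Lemma toMR_eq (f g : merofun) :
  toMR f = toMR g <-> forall a : C, \forall z \near a^', f z = g z.
Proof.
split=> [/eqP|fg]; last apply/eqP; rewrite -Quotient.idealrBE.
  move=> /asboolP fg a; near=> z; apply/eqP; rewrite -subr_eq0; apply/eqP.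
  by near: z; exact: fg.
apply/asboolP => a; near=> z.
have e : f z = g z by near: z; exact: fg.
by rewrite -[LHS]/(f z - g z) e subrr.
Unshelve. all: by end_near.
Qed.

Lemma toMRD (f g : merofun) : toMR (f + g) = toMR f + toMR g.
Proof. by rewrite !piE. Qed.

Lemma toMRM (f g : merofun) : toMR (f * g) = toMR f * toMR g.
Proof. by rewrite !piE. Qed.

Definition MR_scale (c : C) (x : MR) : MR := toMR (c *: repr x).

Lemma toMRZ (c : C) (f : merofun) : toMR (c *: f) = MR_scale c (toMR f).
Proof.
apply/toMR_eq => a; have /toMR_eq/(_ a) : toMR (repr (toMR f)) = toMR f.
  exact: reprK.
by apply: filterS => z e; rewrite -[LHS]/(c * f z) -e.
Qed.

Let MRP (x : MR) : exists f, x = toMR f.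
Proof. by exists (repr x); rewrite reprK. Qed.

Let scaleA (a b : C) (x : MR) :
  MR_scale a (MR_scale b x) = MR_scale (a * b) x.
Proof. by have [f ->] := MRP x; rewrite -!toMRZ scalerA. Qed.

Let scale1 : left_id 1 MR_scale.
Proof. by move=> x; have [f ->] := MRP x; rewrite -!toMRZ scale1r. Qed.

Let scaleDr : right_distributive MR_scale +%R.
Proof.
move=> c x y; have [f ->] := MRP x; have [g ->] := MRP y.
by rewrite -toMRD -!toMRZ -toMRD scalerDr.
Qed.

Let scaleDl (x : MR) : {morph MR_scale^~ x : a b / a + b}.
Proof.
by move=> a b; have [f ->] := MRP x; rewrite -!toMRZ -toMRD scalerDl.
Qed.

HB.instance Definition _ := GRing.Zmodule_isLmodule.Build C MR
  scaleA scale1 scaleDr scaleDl.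

Let scaleAl (c : C) (x y : MR) : c *: (x * y) = (c *: x) * y.
Proof.
have [f ->] := MRP x; have [g ->] := MRP y.
rewrite -[LHS]/(MR_scale _ _) -[c *: toMR f]/(MR_scale _ _).
rewrite -toMRM -!toMRZ -toMRM; congr toMR.
by apply/val_inj/funext => z; exact: mulrA.
Qed.

HB.instance Definition _ := GRing.Lmodule_isLalgebra.Build C MR scaleAl.
HB.instance Definition _ := GRing.Lalgebra_isComAlgebra.Build C MR.

End MeromorphicFunctions.

Record topology (T : Type) := Topology {
  is_open : set_system T;
  is_openT : is_open setT;
  is_openI : setI_closed is_open;
  is_open_bigU : forall (I : Type) (f : I -> set T),
    (forall i, is_open (f i)) -> is_open (\bigcup_i f i) }.

(* Type alias, so that distinct topologies on A can be canonical. *)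
Definition topologized (K : numFieldType) (A : algType K) (tau : topology A) :
  Type := A.

HB.instance Definition _ (K : numFieldType) (A : algType K) (tau : topology A) :=
  GRing.Algebra.copy (topologized tau) A.
HB.instance Definition _ (K : numFieldType) (A : algType K) (tau : topology A) :=
  isOpenTopological.Build (topologized tau)
    (is_openT tau) (@is_openI _ tau) (@is_open_bigU _ tau).

Definition metrizable (R : realType) (T : Type) (tau : topology T) : Prop :=
  exists d : T -> T -> R,
    [/\ forall x y, d x y = 0 <-> x = y,
        forall x y, d x y = d y x,
        forall x y z, d x z <= d x y + d y z &
        forall U : set T, is_open tau U <->
          (forall x, U x -> exists2 e : R, 0 < e & [set y | d x y < e] `<=` U)].

Section TopologicalAlgebra.
Variables (K : numFieldType) (A : algType K) (tau : topology A).
Local Notation X := (topologized tau).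

Definition topological_algebra : Prop :=
  [/\ continuous (fun p : X * X => p.1 + p.2),
      continuous (fun p : K * X => p.1 *: p.2) &
      continuous (fun p : X * X => p.1 * p.2)].

(* Cauchy filters for the translation-invariant uniformity of X, whose
   entourages are the {(x, y) | x - y \in V} with V a neighbourhood of 0. *)
Definition tvs_cauchy (F : set_system X) : Prop :=
  p.1 - p.2 @[p --> (F, F)] --> (0 : X).

Definition tvs_complete : Prop :=
  forall F : set_system X, ProperFilter F -> tvs_cauchy F ->
    exists x : X, F --> x.

Definition complete_topological_algebra : Prop :=
  topological_algebra /\ tvs_complete.

End TopologicalAlgebra.

(* Main.v *)
Require Import Defs.
From mathcomp Require Import all_boot all_order all_algebra.
From mathcomp Require Import generic_quotient complex.
From mathcomp Require Import all_classical all_reals all_analysis.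
From mathcomp Require Import zify ring lra.

(** A complete metrizable algebra topology on the meromorphic functions would
    allow certain infinite systems of equations to be solved, and one of these
    systems cannot be solved because the order of a nonzero meromorphic function
    at 0 is an integer.

    The functional-analytic input is [backward_recursion]: if [F] is continuous
    and [F a e = e], then [p n = F (x n) (p n.+1)], for all [n], can be solved
    with the [x n] in any set that accumulates at [a] and with the [p n] in any
    neighbourhood of [e]. It is used twice. With [F x p = 1 + x * p] and the
    [x n] nonzero multiples of [z ^- 2] tending to 0, it shows that the functions
    with a simple zero at 0 accumulate at 1 ([order_one_dense]): going along the
    solution removes two orders of pole at 0 at each step, and the pole is of
    finite order by definition. So there are [u n] with a simple zero at 0, as
    close to 1 as desired, and with [F u p = u * p ^+ 3] one gets nonzero [p n]
    with [p n = u n * p n.+1 ^+ 3]. If [k n] is the order of [p n] at 0, then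
    [2 * k n + 1 = 3 * (2 * k n.+1 + 1)], so that every power of 3 divides the
    odd number [2 * k 0 + 1], which is absurd ([no_complete_metrizable]).

    The complex-analytic input is that every nonzero meromorphic function has an
    order at 0 ([nonzero_has_order]). Locally, a holomorphic function either
    vanishes near a point or is comparable with a power of the distance to it
    ([holomorphic_dichotomy]); this is extracted from Cauchy's formula, itself a
    consequence of Goursat's theorem. Integrals are avoided by working with
    Riemann sums over boundaries of squares, for which additivity under
    bisection holds exactly ([square_sum_bisect]) and Goursat's theorem says
    that they tend to 0 ([goursat]). Globally, [identity_theorem] propagates
    local vanishing by connectedness of the plane. *)

Set Implicit Arguments.
Unset Strict Implicit.
Unset Printing Implicit Defensive.

Import Order.TTheory GRing.Theory Num.Theory.
Import numFieldNormedType.Exports.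
Import Normc.

Local Notation Re := complex.Re.
Local Notation Im := complex.Im.

Local Open Scope classical_set_scope.
Local Open Scope ring_scope.
Local Open Scope complex_scope.

(** * Modulus of a complex number *)

Section Modulus.
Variable R : realType.
Implicit Types (z w : R[i]) (r : R).

(** [normc] is the real-valued modulus; the norm of the number field [R[i]]
    takes its values in [R[i]] itself. *)
Lemma norm_normc z : `|z| = (normc z)%:C.
Proof. by []. Qed.

Lemma normc_ge0 z : 0 <= normc z.
Proof. by case: z => a b; rewrite sqrtr_ge0. Qed.

Lemma normcB z w : normc (z - w) <= normc z + normc w.
Proof. by rewrite -(normcN w) le_normcD. Qed.

Lemma normcBC z w : normc (z - w) = normc (w - z).
Proof. by rewrite -normcN opprB. Qed.

Lemma normc_triB z w : normc z - normc w <= normc (z - w).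
Proof. by rewrite lerBlDr -{1}(subrK w z) le_normcD. Qed.

Lemma normc_real r : normc r%:C = `|r|.
Proof. by rewrite /= expr0n addr0 sqrtr_sqr. Qed.

Lemma normcX z n : normc (z ^+ n) = normc z ^+ n.
Proof. by elim: n => [|n ih]; rewrite ?expr0 ?normc1 // !exprS normcM ih. Qed.

Lemma normc_i : normc ('i : R[i]) = 1.
Proof. by rewrite /= expr0n add0r expr1n sqrtr1. Qed.

Lemma normc_eq0 z : (normc z == 0) = (z == 0).
Proof. by apply/eqP/eqP => [/eq0_normc|->] //; exact: normc0. Qed.

Lemma normc_gt0 z : (0 < normc z) = (z != 0).
Proof. by rewrite lt_def normc_eq0 normc_ge0 andbT. Qed.

Lemma normc_sum (n : nat) (F : 'I_n -> R[i]) :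
  normc (\sum_(i < n) F i) <= \sum_(i < n) normc (F i).
Proof.
elim/big_ind2: _ => //; first by rewrite normc0.
by move=> x1 x2 y1 y2 h1 h2; apply: le_trans (le_normcD _ _) (lerD h1 h2).
Qed.

Lemma Re_le_normc z : `|Re z| <= normc z.
Proof.
case: z => a b /=; rewrite -sqrtr_sqr ler_wsqrtr //.
by rewrite lerDl sqr_ge0.
Qed.

Lemma Im_le_normc z : `|Im z| <= normc z.
Proof.
case: z => a b /=; rewrite -sqrtr_sqr ler_wsqrtr //.
by rewrite lerDr sqr_ge0.
Qed.

Lemma normc_le_ReIm z : normc z <= `|Re z| + `|Im z|.
Proof.
case: z => a b /=; rewrite -[leRHS]ger0_norm ?addr_ge0 // -sqrtr_sqr.
rewrite ler_wsqrtr // sqrrD !real_normK ?num_real //.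
by rewrite addrAC lerDl mulrn_wge0 // mulr_ge0.
Qed.

Lemma pow2_small (x r : R) : 0 <= x -> 0 < r -> exists n, x / 2 ^+ n < r.
Proof.
move=> x0 r0; exists (Num.bound (x / r)).
rewrite ltr_pdivrMr ?exprn_gt0 // [ltRHS]mulrC -ltr_pdivrMr //.
apply: lt_trans (archi_boundP _) _; first by rewrite divr_ge0 // ltW.
by rewrite -natrX ltr_nat ltn_expl.
Qed.

End Modulus.

(** * Riemann sums along the boundary of a square *)

Section BoundarySums.
Variable R : realType.
Local Notation C := R[i].
Implicit Types (f g : C -> C) (c h z : C) (N : nat).

Definition edge_sum f c h N : C := \sum_(k < N) f (c + k%:R * h).

(** The left-endpoint Riemann sum, with [N] points per edge, of the integral of
    [f] over the boundary of the square with lower left corner [c] and side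
    [N * h]. Before any limit is taken, these sums already satisfy the two
    identities on which Goursat's argument rests, [square_sum_bisect] and
    [square_sum_affine]. *)
Definition square_sum f c h N : C :=
  h * (edge_sum f c h N - edge_sum f (c + 'i * (N%:R * h)) h N
    + 'i * (edge_sum f (c + N%:R * h) ('i * h) N - edge_sum f c ('i * h) N)).

Lemma edge_sum_cat f c h N :
  edge_sum f c h (N + N) = edge_sum f c h N + edge_sum f (c + N%:R * h) h N.
Proof.
rewrite /edge_sum big_split_ord /=; congr (_ + _); apply: eq_bigr => k _.
by rewrite natrD; congr f; ring.
Qed.

(** The four quarters share the mesh [h] of the whole square, so that the sums
    over an edge common to two quarters are the same and cancel. *)
Lemma square_sum_bisect f c h N :
  square_sum f c h (N + N) = square_sum f c h N
    + square_sum f (c + N%:R * h) h N + square_sum f (c + 'i * (N%:R * h)) h N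
    + square_sum f (c + N%:R * h + 'i * (N%:R * h)) h N.
Proof.
rewrite /square_sum !edge_sum_cat natrD.
have -> : c + 'i * ((N%:R + N%:R) * h) + N%:R * h =
  c + N%:R * h + 'i * (N%:R * h) + 'i * (N%:R * h) by ring.
have -> : c + 'i * ((N%:R + N%:R) * h) =
  c + 'i * (N%:R * h) + 'i * (N%:R * h) by ring.
have -> : c + (N%:R + N%:R) * h + N%:R * ('i * h) =
  c + N%:R * h + 'i * (N%:R * h) + N%:R * h by ring.
have -> : c + (N%:R + N%:R) * h = c + N%:R * h + N%:R * h by ring.
have -> : c + N%:R * ('i * h) = c + 'i * (N%:R * h) by ring.
have -> : c + 'i * (N%:R * h) + N%:R * h = c + N%:R * h + 'i * (N%:R * h) by ring.
ring.
Qed.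

Lemma edge_sumB f g c h N :
  edge_sum (fun z => f z - g z) c h N = edge_sum f c h N - edge_sum g c h N.
Proof. by rewrite /edge_sum sumrB. Qed.

Lemma edge_sumZ (a : C) f c h N :
  edge_sum (fun z => a * f z) c h N = a * edge_sum f c h N.
Proof. by rewrite /edge_sum mulr_sumr. Qed.

Lemma square_sumB f g c h N :
  square_sum (fun z => f z - g z) c h N = square_sum f c h N - square_sum g c h N.
Proof. by rewrite /square_sum !edge_sumB; ring. Qed.

Lemma edge_sumD f g c h N :
  edge_sum (fun z => f z + g z) c h N = edge_sum f c h N + edge_sum g c h N.
Proof. by rewrite /edge_sum big_split. Qed.

Lemma square_sumD f g c h N :
  square_sum (fun z => f z + g z) c h N = square_sum f c h N + square_sum g c h N.
Proof. by rewrite /square_sum !edge_sumD; ring. Qed.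

Lemma square_sumZ (a : C) f c h N :
  square_sum (fun z => a * f z) c h N = a * square_sum f c h N.
Proof. by rewrite /square_sum !edge_sumZ; ring. Qed.

Lemma edge_sum_affine (a b c d h : C) N :
  edge_sum (fun z => a + b * z) (c + d) h N =
  edge_sum (fun z => a + b * z) c h N + N%:R * (b * d).
Proof.
have -> : N%:R * (b * d) = \sum_(k < N) b * d.
  by rewrite sumr_const card_ord mulr_natl.
by rewrite /edge_sum -big_split; apply: eq_bigr => k _ /=; ring.
Qed.

(** Moving an edge to the opposite one changes the sum of [a + b * z] by
    [N%:R * b] times the displacement. The displacement of the horizontal edges
    is ['i] times that of the vertical ones, and the latter carry the factor
    ['i]. *)
Lemma square_sum_affine (a b c h : C) N :
  square_sum (fun z => a + b * z) c h N = 0.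
Proof. by rewrite /square_sum !edge_sum_affine; ring. Qed.

Definition in_square (x y t : R) z :=
  (x <= Re z <= x + t) /\ (y <= Im z <= y + t).

Definition on_square (x y t : R) z := in_square x y t z /\
  [\/ Re z = x, Re z = x + t, Im z = y | Im z = y + t].

Local Notation ssum f x y t N := (square_sum f (x +i* y) (t / N%:R)%:C N).

Lemma edge_sum_bound f c h N (B : R) :
  (forall k : 'I_N, normc (f (c + k%:R * h)) <= B) ->
  normc (edge_sum f c h N) <= N%:R * B.
Proof.
move=> fB; apply: le_trans (normc_sum _) _.
apply: le_trans (ler_sum _ (fun k _ => fB k)) _.
by rewrite sumr_const card_ord mulr_natl.
Qed.

Lemma natr_complex (k : nat) : (k%:R : C) = (k%:R)%:C.
Proof. by rewrite rmorph_nat. Qed.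

Let frac_bound (t : R) (N : nat) (k : 'I_N) : 0 <= t ->
  0 <= k%:R * (t / N%:R) <= t.
Proof.
move=> t0; rewrite mulr_ge0 ?divr_ge0 //= mulrCA ler_piMr //.
have N0 : (0 < N)%N by case: N k => // -[].
by rewrite ler_pdivrMr ?ltr0n // mul1r ler_nat ltnW.
Qed.

Let fracK (t : R) (N : nat) : (0 < N)%N -> N%:R * (t / N%:R) = t :> R.
Proof. by move=> N0; rewrite mulrC divfK // pnatr_eq0 -lt0n. Qed.

Lemma square_sum_pts (P : C -> Prop) x y t N : 0 <= t -> (0 < N)%N ->
  (forall z, on_square x y t z -> P z) ->
  forall k : 'I_N, let h : C := (t / N%:R)%:C in let c := x +i* y in
  [/\ P (c + k%:R * h), P (c + 'i * (N%:R * h) + k%:R * h),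
      P (c + N%:R * h + k%:R * ('i * h)) & P (c + k%:R * ('i * h))].
Proof.
move=> t0 N0 HP k h c; rewrite /h /c !natr_complex.
have /andP[k0 k1] := frac_bound k t0; have := fracK t N0.
move: k0 k1; set u := k%:R * (t / N%:R); set v := N%:R * (t / N%:R).
move=> k0 k1 vt; split; apply: HP; rewrite /on_square /in_square /=;
rewrite !(mul0r, mulr0, mul1r, subr0, addr0, add0r) -/u -/v ?vt;
(split; first by lra).
- by apply: Or43; lra.
- by apply: Or44; lra.
- by apply: Or42; lra.
- by apply: Or41; lra.
Qed.

Lemma square_sum_bound f x y t N (B : R) : 0 <= t -> (0 < N)%N ->
  (forall z, on_square x y t z -> normc (f z) <= B) ->
  normc (ssum f x y t N) <= 4 * t * B.
Proof.
move=> t0 N0 fB; have pts := square_sum_pts t0 N0 fB.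
rewrite /square_sum normcM normc_real ger0_norm ?divr_ge0 //.
set e1 := edge_sum _ _ _ _; set e2 := edge_sum _ _ _ _.
set e3 := edge_sum _ _ _ _; set e4 := edge_sum _ _ _ _.
have b1 : normc e1 <= N%:R * B by apply: edge_sum_bound => k; have [] := pts k.
have b2 : normc e2 <= N%:R * B by apply: edge_sum_bound => k; have [] := pts k.
have b3 : normc e3 <= N%:R * B by apply: edge_sum_bound => k; have [] := pts k.
have b4 : normc e4 <= N%:R * B by apply: edge_sum_bound => k; have [] := pts k.
have -> : 4 * t * B = t / N%:R * (4 * (N%:R * B)).
  by rewrite -[in LHS](fracK t N0); ring.
rewrite ler_wpM2l ?divr_ge0 //.
have := le_normcD (e1 - e2) ('i * (e3 - e4)); rewrite normcM normc_i mul1r.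
have := normcB e1 e2; have := normcB e3 e4; lra.
Qed.

Lemma eq_square_sum f g x y t N : 0 <= t -> (0 < N)%N ->
  (forall z, on_square x y t z -> f z = g z) ->
  ssum f x y t N = ssum g x y t N.
Proof.
move=> t0 N0 fg; apply/eqP; rewrite -subr_eq0 -square_sumB -normc_eq0.
rewrite eq_le normc_ge0 andbT -(mulr0 (4 * t)).
by apply: square_sum_bound => // z /fg ->; rewrite subrr normc0.
Qed.

End BoundarySums.

(** * Goursat's theorem *)

Section Goursat.
Variable R : realType.
Local Notation C := R[i].
Implicit Types (f g : C -> C) (c h z p w : C) (N : nat) (x y t : R).

Local Notation ssum f x y t N := (square_sum f (x +i* y) (t / N%:R)%:C N).

Lemma ssum_bisect f x y t m :
  ssum f x y t (2 ^ m.+1) =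
    ssum f x y (t / 2) (2 ^ m) + ssum f (x + t / 2) y (t / 2) (2 ^ m)
    + ssum f x (y + t / 2) (t / 2) (2 ^ m)
    + ssum f (x + t / 2) (y + t / 2) (t / 2) (2 ^ m).
Proof.
have -> : t / (2 ^ m.+1)%:R = t / 2 / (2 ^ m)%:R.
  by rewrite expnS natrM invfM mulrA.
rewrite expnS mul2n -addnn square_sum_bisect.
have -> : (2 ^ m)%:R * (t / 2 / (2 ^ m)%:R)%:C = (t / 2)%:C :> C.
  rewrite natr_complex -rmorphM; congr _%:C.
  by rewrite mulrC divfK // pnatr_eq0 expn_eq0.
have cE (a b : R) : a +i* b = a%:C + 'i * b%:C :> C.
  by rewrite /= /real_complex_def; simpc.
by rewrite !cE !rmorphD !mulrDr !addrA
  (addrAC _ (t / 2)%:C ('i * y%:C)).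
Qed.

Lemma nested_intervals (a l : nat -> R) :
  (forall n, 0 <= l n) -> (forall n, a n <= a n.+1) ->
  (forall n, a n.+1 + l n.+1 <= a n + l n) ->
  exists p : R, forall n, a n <= p <= a n + l n.
Proof.
move=> l0 ainc bdec.
have aM m n : (m <= n)%N -> a m <= a n.
  by move/subnK <-; elim: (n - m)%N => // k ih; exact: le_trans ih (ainc _).
have bM m n : (m <= n)%N -> a n + l n <= a m + l m.
  by move/subnK <-; elim: (n - m)%N => // k ih; exact: le_trans (bdec _) ih.
have ab m n : a m <= a n + l n.
  have [mn|/ltnW nm] := leqP m n.
    by apply: le_trans (aM _ _ mn) _; rewrite lerDl.
  by apply: le_trans (bM _ _ nm); rewrite lerDl.
exists (sup (range a)) => n; apply/andP; split.
  apply: ub_le_sup; last by exists n.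
  by exists (a 0 + l 0) => _ [m _ <-].
apply: ge_sup; first by exists (a 0); exists 0.
by move=> _ [m _ <-].
Qed.

Lemma nested_squares (P : R -> R -> R -> Prop) x y t : 0 <= t ->
  (forall x y t, 0 <= t -> P x y t -> exists x' y',
    [/\ x' = x \/ x' = x + t / 2, y' = y \/ y' = y + t / 2 & P x' y' (t / 2)]) ->
  P x y t ->
  exists p, in_square x y t p /\
    forall n, exists x' y', P x' y' (t / 2 ^+ n) /\ in_square x' y' (t / 2 ^+ n) p.
Proof.
move=> t0 Pstep Pxyt.
have : forall q : R * R * R, exists q' : R * R, 0 <= q.2 -> P q.1.1 q.1.2 q.2 ->
    [/\ q'.1 = q.1.1 \/ q'.1 = q.1.1 + q.2 / 2,
        q'.2 = q.1.2 \/ q'.2 = q.1.2 + q.2 / 2 & P q'.1 q'.2 (q.2 / 2)].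
  move=> [[a b] s] /=; have [[s0 Ps]|] := pselect (0 <= s /\ P a b s).
    by have [a' [b' h]] := Pstep _ _ _ s0 Ps; exists (a', b').
  by move=> nP; exists (0, 0) => s0 Ps; case: nP.
move=> /choice[next nextP].
pose l n := t / 2 ^+ n.
pose q := fix q n := if n is n'.+1 then next (q n', l n') else (x, y).
have l0 n : 0 <= l n by rewrite divr_ge0 ?exprn_ge0.
have lS n : l n.+1 = l n / 2 by rewrite /l exprSr invfM mulrA.
have Pq n : P (q n).1 (q n).2 (l n).
  elim: n => [|n ih]; first by rewrite /l expr0 divr1.
  by have [] := nextP (q n, l n) (l0 n) ih; rewrite lS.
have qS n := nextP (q n, l n) (l0 n) (Pq n).
have [p1 p1P] : exists p : R, forall n, (q n).1 <= p <= (q n).1 + l n.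
  apply: nested_intervals => // n; have [/= h _ _] := qS n; have := l0 n;
    rewrite /= ?lS; case: h => ->; lra.
have [p2 p2P] : exists p : R, forall n, (q n).2 <= p <= (q n).2 + l n.
  apply: nested_intervals => // n; have [/= _ h _] := qS n; have := l0 n;
    rewrite /= ?lS; case: h => ->; lra.
exists (p1 +i* p2); split.
  by have := p1P 0; have := p2P 0; rewrite /l expr0 divr1.
by move=> n; exists (q n).1, (q n).2; split; [exact: Pq|split; rewrite /=].
Qed.

Definition complex_diff f p := exists d, forall e : R, 0 < e ->
  exists2 r : R, 0 < r & forall z, normc (z - p) < r ->
    normc (f z - f p - d * (z - p)) <= e * normc (z - p).

(** Convergence to 0 for the real-valued modulus. *)
Definition vanishing (u : nat -> C) := forall e : R, 0 < e ->
  exists m0, forall m, (m0 <= m)%N -> normc (u m) <= e.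

(** The two half-open intervals with end points [y] and [y + t] are counted
    separately: the count is additive under bisection, which the indicator of
    the closed interval is not, and it is at least 1 on the closed interval. *)
Let row_weight (y v t : R) : R := (y <= v < y + t)%R%:R + (y < v <= y + t)%R%:R.

Let row_weight_half (y v t : R) : 0 <= t ->
  row_weight y v t = row_weight y v (t / 2) + row_weight (y + t / 2) v (t / 2).
Proof.
move=> t0; rewrite /row_weight (_ : y + t / 2 + t / 2 = y + t); last by field.
have h1 : y <= y + t / 2 by lra.
have h2 : y + t / 2 <= y + t by lra.
rewrite addrACA; congr (_ + _).
- case: (ltP v (y + t / 2)) => hv.
    by rewrite (lt_le_trans hv h2) !andbT addr0.
  by rewrite (le_trans h1 hv) andbF add0r.
- case: (leP v (y + t / 2)) => hv.
    by rewrite (le_trans hv h2) !andbT addr0.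
  by rewrite (le_lt_trans h1 hv) andbF add0r.
Qed.

Let row_weight_ge1 (y v t : R) : 0 < t -> y <= v <= y + t -> 1 <= row_weight y v t.
Proof.
move=> t0 /andP[yv vt]; rewrite /row_weight yv vt /=.
have [_|tv] := ltP v (y + t); first by rewrite lerDl.
have -> : y < v by lra.
by rewrite add0r.
Qed.

Let row_weight_ge0 (y v t : R) : 0 <= row_weight y v t.
Proof. by rewrite addr_ge0. Qed.

Lemma in_square_dist x y t p z : in_square x y t p -> in_square x y t z ->
  normc (z - p) <= 2 * t.
Proof.
case=> /andP[a1 a2] /andP[a3 a4] [/andP[b1 b2] /andP[b3 b4]].
apply: le_trans (normc_le_ReIm _) _.
case: p z a1 a2 a3 a4 b1 b2 b3 b4 => [p1 p2] [z1 z2] /= a1 a2 a3 a4 b1 b2 b3 b4.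
have : `|z1 - p1| <= t by rewrite ler_norml; lra.
have : `|z2 - p2| <= t by rewrite ler_norml; lra.
lra.
Qed.

(** Goursat's theorem for the sums [square_sum], allowing one exceptional point
    [w] where [f] is only continuous. In the usual bisection argument the error
    allowed on a subsquare is proportional to its area. Here one adds to the
    area of a square the length of its intersection with the horizontal line
    through [w], counted once or twice by [row_weight]: this is still additive
    under bisection, and for a small square around [w] it dominates the side,
    which is the bound that continuity at [w] provides. *)
Lemma goursat f w x y t : 0 < t ->
  (forall p, in_square x y t p -> p != w -> complex_diff f p) ->
  (forall e : R, 0 < e -> exists2 r : R, 0 < r &
     forall z, normc (z - w) < r -> normc (f z - f w) <= e) ->
  vanishing (fun m => ssum f x y t (2 ^ m)).
Proof.
move=> t_gt0 fdiff fcont e e0.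
pose W x' y' t' := t' ^+ 2 + t' * row_weight y' (Im w) t'.
have W_gt0 : 0 < W x y t.
  by rewrite ltr_pwDl ?exprn_gt0 // mulr_ge0 ?row_weight_ge0 // ltW.
pose eta := e / W x y t.
have eta0 : 0 < eta by rewrite divr_gt0.
pose good x' y' t' := exists m0, forall m, (m0 <= m)%N ->
  normc (ssum f x' y' t' (2 ^ m)) <= eta * W x' y' t'.
suff [m0 gm0] : good x y t.
  by exists m0 => m /gm0; rewrite /eta divfK // gt_eqF.
apply: contrapT => bad.
(* If the square is not good, one of its quarters is not good either; the
   nested bad squares shrink to a point p, near which every square is good. *)
pose P x' y' t' := ~ good x' y' t'.
have [|p [pin pP]] := @nested_squares P x y t (ltW t_gt0) _ bad.
  move=> a b s s0 nG.
  apply: contrapT => H.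
  have G a' b' : a' = a \/ a' = a + s / 2 -> b' = b \/ b' = b + s / 2 ->
      good a' b' (s / 2).
    by move=> ha hb; apply: contrapT => nG'; apply: H; exists a', b'.
  apply: nG.
  have [m1 H1] := G _ _ (or_introl erefl) (or_introl erefl).
  have [m2 H2] := G _ _ (or_intror erefl) (or_introl erefl).
  have [m3 H3] := G _ _ (or_introl erefl) (or_intror erefl).
  have [m4 H4] := G _ _ (or_intror erefl) (or_intror erefl).
  exists (maxn (maxn m1 m2) (maxn m3 m4)).+1 => -[//|m].
  rewrite ltnS !geq_max => /andP[/andP[/H1 h1 /H2 h2] /andP[/H3 h3 /H4 h4]].
  rewrite ssum_bisect.
  apply: le_trans (le_normcD _ _) _.
  apply: le_trans (lerD (le_normcD _ _) h4) _.
  apply: le_trans (lerD (lerD (le_normcD _ _) h3) (lexx _)) _.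
  apply: le_trans (lerD (lerD (lerD h1 h2) (lexx _)) (lexx _)) _.
  rewrite -!mulrDr ler_wpM2l ?(ltW eta0) // /W (@row_weight_half b (Im w) s) //.
  by rewrite le_eqVlt; apply/orP; left; apply/eqP; field.
have small (r : R) : 0 < r -> exists n, 2 * (t / 2 ^+ n) < r.
  move=> /(pow2_small (mulr_ge0 (ler0n R 2) (ltW t_gt0)))[n h].
  by exists n; rewrite mulrA.
have tn0 n : 0 < t / 2 ^+ n by rewrite divr_gt0 // exprn_gt0.
have [pw|pw] := eqVneq p w.
  have [r r0 hr] := fcont _ (divr_gt0 eta0 (ltr0n _ 4)).
  have [n hn] := small r r0.
  have [x' [y' [nG sq]]] := pP n; apply: nG; exists 0 => m _.
  have -> : ssum f x' y' (t / 2 ^+ n) (2 ^ m) =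
      ssum (fun z => f z - (f w + 0 * z)) x' y' (t / 2 ^+ n) (2 ^ m).
    by rewrite square_sumB square_sum_affine subr0.
  apply: le_trans (square_sum_bound (B := eta / 4) _ _ _) _.
  - exact: ltW.
  - by rewrite expn_gt0.
  - move=> z [zsq _]; rewrite mul0r addr0; apply: hr; rewrite -pw.
    exact: le_lt_trans (in_square_dist sq zsq) hn.
  - have -> : 4 * (t / 2 ^+ n) * (eta / 4) = eta * (t / 2 ^+ n * 1) by field.
    rewrite ler_wpM2l ?(ltW eta0) // /W.
    have := row_weight_ge1 (tn0 n) sq.2; rewrite pw => wt.
    by rewrite ler_wpDl ?exprn_ge0 ?ler_wpM2l // ltW.
have [d hd] := fdiff p pin pw.
have [r r0 hr] := hd _ (divr_gt0 eta0 (ltr0n _ 8)).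
have [n hn] := small r r0.
have [x' [y' [nG sq]]] := pP n; apply: nG; exists 0 => m _.
have -> : ssum f x' y' (t / 2 ^+ n) (2 ^ m) =
    ssum (fun z => f z - ((f p - d * p) + d * z)) x' y' (t / 2 ^+ n) (2 ^ m).
  by rewrite square_sumB square_sum_affine subr0.
apply: le_trans (square_sum_bound (B := eta / 8 * (2 * (t / 2 ^+ n))) _ _ _) _.
- exact: ltW.
- by rewrite expn_gt0.
- move=> z [zsq _]; have dz := in_square_dist sq zsq.
  have -> : f z - (f p - d * p + d * z) = f z - f p - d * (z - p) by ring.
  apply: le_trans (hr _ (le_lt_trans dz hn)) _.
  by rewrite ler_wpM2l // ltW // divr_gt0.
- rewrite [leLHS](_ : _ = eta * (t / 2 ^+ n) ^+ 2); last by field.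
  by rewrite ler_wpM2l ?(ltW eta0) // lerDl mulr_ge0 ?row_weight_ge0 // ltW.
Qed.

End Goursat.

(** * Complex differentiability *)

Section Bridge.
Variable R : realType.
Local Notation C := (R[i] : numFieldType).

Lemma nbhs_complexP (p : C) (P : set C) : (\forall z \near p, P z) <->
  exists2 r : R, 0 < r & forall z : R[i], normc (z - p) < r -> P z.
Proof.
split.
  move=> /nbhs_ballP[e /= e0 he].
  have eR : e = (Re e)%:C by rewrite RRe_real // gtr0_real.
  exists (Re e); first by rewrite -ltcR -eR.
  move=> z zr; apply: he; rewrite /ball /=.
  by rewrite distrC norm_normc eR ltcR.
move=> [r r0 hr]; apply/nbhs_ballP; exists r%:C; first by rewrite /= ltcR.
by move=> z /=; rewrite /ball /= distrC norm_normc ltcR => /hr.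
Qed.

Lemma dnbhs_complexP (p : C) (P : set C) : (\forall z \near p^', P z) <->
  exists2 r : R, 0 < r & forall z : R[i], normc (z - p) < r -> z != p -> P z.
Proof. exact: (nbhs_complexP p (fun z => z != p -> P z)). Qed.

Lemma derivable_complex_diff (f : C -> C) (p : C) :
  derivable f p 1 -> complex_diff f p.
Proof.
move=> /cvg_ex[/= d /(@cvgrPdist_le C C) fd]; exists d => e e0.
have e0' : 0 < e%:C by rewrite ltcR.
have /dnbhs_complexP[r r0 hr] := fd _ e0'.
exists r => // z zr.
have [->|zp] := eqVneq z p; first by rewrite !subrr mulr0 subr0 normc0 mulr0.
have zp0 : z - p != 0 by rewrite subr_eq0.
have := hr (z - p); rewrite subr0 => /(_ zr zp0).
rewrite /= [(z - p) *: 1]mulr1 subrK norm_normc lecR => h.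
have key (a x u : R[i]) : x != 0 -> u - a * x = - (x * (a - x^-1 * u)).
  by move=> x0; field.
rewrite (key d (z - p) (f z - f p) zp0) normcN normcM mulrC.
by apply: ler_wpM2r h; exact: normc_ge0.
Qed.

Lemma derivable_quotient (g : C -> C) (w p : C) : derivable g p 1 -> p != w ->
  derivable (fun z => (g z - g w) * (z - w)^-1) p 1.
Proof.
move=> gp pw.
have dg : derivable (g - cst (g w)) p 1.
  by apply: derivableB; [exact: gp|exact: derivable_cst].
have dz : derivable (id - cst w : C -> C) p 1.
  by apply: derivableB; [exact: derivable_id|exact: derivable_cst].
have pw0 : (id - cst w : C -> C) p != 0 by rewrite subr_eq0.
exact: (derivableM dg (derivableV pw0 dz)).
Qed.

Lemma derivable_affine (g : C -> C) (a r p : C) : derivable g (a + r * p) 1 ->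
  derivable (fun z => g (a + r * z)) p 1.
Proof.
move=> /derivable1_diffP gp; apply/derivable1_diffP.
have dz : differentiable (cst a + cst r * id : C -> C) p.
  apply/derivable1_diffP; apply: derivableD; first exact: derivable_cst.
  by apply: derivableM; [exact: derivable_cst|exact: derivable_id].
exact: (differentiable_comp dz gp).
Qed.

Lemma derivable_bounded (g : C -> C) (p : C) : derivable g p 1 ->
  exists2 r : R, 0 < r & forall z : R[i], normc (z - p) < r ->
    normc (g z) <= normc (g p) + 1.
Proof.
move=> /derivable1_diffP/differentiable_continuous.
move=> /cvgrPdist_le/(_ 1 ltr01)/nbhs_complexP[r r0 hr]; exists r => // z /hr.
rewrite norm_normc -(rmorph1 (real_complex R)) lecR => h.
by rewrite addrC -lerBlDr (le_trans (normc_triB _ _)) // normcBC.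
Qed.

End Bridge.

(** * Local behaviour of holomorphic functions *)

Section LocalOrder.
Variable R : realType.
Local Notation C := (R[i] : numFieldType).
Local Notation Q := (@in_square R (- 1) (- 1) 2).
Local Notation dQ := (@on_square R (- 1) (- 1) 2).

Definition contour_sum (f : R[i] -> R[i]) m :=
  square_sum f (- 1 +i* - 1) (2 / (2 ^ m)%:R)%:C (2 ^ m).

Let twopow_gt0 m : (0 < 2 ^ m)%N. Proof. by rewrite expn_gt0. Qed.

Let dQ_norm_ge1 z : dQ z -> 1 <= normc z.
Proof.
case: z => a b [_ /=].
have hRe := Re_le_normc (a +i* b); have hIm := Im_le_normc (a +i* b).
move: hRe hIm => /=; move: (Num.sqrt _) => s hRe hIm.
have -> : - 1 + 2 = 1 :> R by lra.
by move=> [] e; move: hRe hIm; rewrite e ?normrN normr1 => hRe hIm.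
Qed.

Let dQ_dist z w : dQ z -> normc w <= 1 / 2 -> 1 / 2 <= normc (z - w).
Proof. by move=> /dQ_norm_ge1 h1 h2; have := normc_triB z w; lra. Qed.

Let dQ_neq z w : dQ z -> normc w <= 1 / 2 -> z - w != 0.
Proof. by move=> zQ /(dQ_dist zQ) h; rewrite -normc_gt0; lra. Qed.

Let half_in_Q w : normc w <= 1 / 2 -> Q w.
Proof.
move=> wh; have := le_trans (Re_le_normc w) wh; have := le_trans (Im_le_normc w) wh.
by rewrite !ler_norml => /andP[h1 h2] /andP[h3 h4]; split; lra.
Qed.

(** Cauchy's formula, before passing to the limit: the difference quotient of
    [g] at [w] is holomorphic off [w] and continuous at [w], so that [goursat]
    applies to it. *)
Lemma cauchy_formula (g : R[i] -> R[i]) w :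
  (forall p, Q p -> derivable (g : C -> C) p 1) ->
  normc w <= 1 / 2 ->
  vanishing (fun m => contour_sum (fun z => g z * (z - w)^-1) m
    - g w * contour_sum (fun z => (z - w)^-1) m).
Proof.
move=> dg wh.
have [d dP] := derivable_complex_diff (dg w (half_in_Q wh)).
pose k z := if z == w then d else (g z - g w) * (z - w)^-1.
have kE z : z != w -> k z = (g z - g w) * (z - w)^-1.
  by rewrite /k => /negbTE ->.
have kdiff p : Q p -> p != w -> complex_diff k p.
  move=> pQ pw.
  have [d' d'P] := derivable_complex_diff (derivable_quotient (dg p pQ) pw).
  exists d' => e e0; have [r r0 hr] := d'P e e0.
  exists (Num.min r (normc (w - p))).
    by rewrite lt_min r0 normc_gt0 subr_eq0 eq_sym.
  move=> z; rewrite lt_min => /andP[zr zw]; rewrite !kE //; first exact: hr.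
  by apply: contraTneq zw => ->; rewrite ltxx.
have kcont e : 0 < e -> exists2 r, 0 < r &
    forall z, normc (z - w) < r -> normc (k z - k w) <= e.
  move=> e0; have [r r0 hr] := dP e e0; exists r => // z zr.
  have [->|zw] := eqVneq z w; first by rewrite subrr normc0 ltW.
  have zw0 : z - w != 0 by rewrite subr_eq0.
  have key (a x u : R[i]) : x != 0 -> u * x^-1 - a = (u - a * x) * x^-1.
    by move=> x0; field.
  rewrite kE // /k eqxx key // normcM normcV ler_pdivrMr ?normc_gt0 //.
  exact: hr.
have := goursat (ltr0n R 2) kdiff kcont.
move=> van e /van[m0 hm0]; exists m0 => m /hm0.
congr (normc _ <= e); rewrite /contour_sum -square_sumZ -square_sumB.
apply: eq_square_sum => // z zQ; have zw := dQ_neq zQ wh.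
rewrite kE; first exact: mulrBl.
by move: zw; rewrite subr_eq0.
Qed.

Lemma edge_sum_lower (phi : R[i] -> R) (f : R[i] -> R[i]) c h N (b : R) :
  phi 0 = 0 -> {morph phi : x y / x + y} ->
  (forall k : 'I_N, b <= phi (f (c + k%:R * h))) ->
  N%:R * b <= phi (edge_sum f c h N).
Proof.
move=> phi0 phiD hb; rewrite /edge_sum.
have -> : phi (\sum_(k < N) f (c + k%:R * h)) =
    \sum_(k < N) phi (f (c + k%:R * h)) by exact: (big_morph phi phiD phi0).
rewrite mulr_natl; apply: le_trans (ler_sum _ (fun k _ => hb k)).
by rewrite sumr_const card_ord.
Qed.

Let inv_part_bound (a b : R) : 1 / 2 <= b -> b <= 3 / 2 ->
  - (3 / 2) <= a -> a <= 3 / 2 -> 1 / 9 <= b / (a ^+ 2 + b ^+ 2).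
Proof.
move=> b1 b2 a1 a2.
have b20 : 0 < b ^+ 2 by rewrite exprn_gt0 //; lra.
have s0 : 0 < a ^+ 2 + b ^+ 2 by rewrite ltr_wpDl // sqr_ge0.
rewrite ler_pdivlMr //.
have : a ^+ 2 <= 9 / 4 by nra.
have : b ^+ 2 <= 9 / 4 by nra.
lra.
Qed.

(** This replaces the value of the integral of [1 / (z - w)], which is [2 i pi]:
    along each edge of the boundary, run counterclockwise, [dz / (z - w)] has
    positive imaginary part. *)
Lemma kernel_sum_lower w m : normc w <= 1 / 2 ->
  1 / 2 <= normc (contour_sum (fun z => (z - w)^-1) m).
Proof.
move=> wh; apply: le_trans (Im_le_normc _); rewrite ler_normr; apply/orP; left.
have := le_trans (Re_le_normc w) wh; have := le_trans (Im_le_normc w) wh.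
rewrite !ler_norml; case: w {wh} => w1 w2 /= /andP[i1 i2] /andP[r1 r2].
set N := (2 ^ m)%N; set eta := 2 / N%:R : R.
have N0 : (N%:R : R) != 0 by rewrite pnatr_eq0 -lt0n twopow_gt0.
have Neta : N%:R * eta = 2 by rewrite mulrC divfK.
have kb (k : 'I_N) : 0 <= k%:R * eta <= 2.
  rewrite mulr_ge0 ?divr_ge0 //= -Neta ler_wpM2r ?divr_ge0 //.
  by rewrite ler_nat ltnW.
have invE (a b : R) : (a +i* b)^-1 =
  (a / (a ^+ 2 + b ^+ 2)) -i* (b / (a ^+ 2 + b ^+ 2)) :> R[i] by [].
rewrite /contour_sum /square_sum -/N -/eta.
set E1 := edge_sum _ _ _ _; set E2 := edge_sum _ _ _ _.
set E3 := edge_sum _ _ _ _; set E4 := edge_sum _ _ _ _.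
have Ceq (a b : R[i]) : Re a = Re b -> Im a = Im b -> a = b.
  by case: a b => [? ?] [? ?] /= -> ->.
have ImD : {morph (@complex.Im R) : x y / x + y} by case=> ? ? [? ?].
have ReD : {morph (@complex.Re R) : x y / x + y} by case=> ? ? [? ?].
have L1 : N%:R * (1 / 9) <= Im E1.
  apply: edge_sum_lower => // k; have /andP[k1 k2] := kb k.
  have -> : - 1 +i* - 1 + k%:R * eta%:C - (w1 +i* w2) =
      (k%:R * eta - 1 - w1) +i* (- 1 - w2).
    by rewrite natr_complex; apply: Ceq => /=; ring.
  by rewrite invE /= -mulNr -(sqrrN (- 1 - w2)); apply: inv_part_bound; lra.
have L2 : N%:R * (1 / 9) <= - Im E2.
  apply: (@edge_sum_lower (fun z => - Im z)) => [|x y|k] /=.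
  - by rewrite oppr0.
  - by rewrite ImD opprD.
  have /andP[k1 k2] := kb k.
  have -> : - 1 +i* - 1 + 'i * (N%:R * eta%:C) + k%:R * eta%:C - (w1 +i* w2) =
      (k%:R * eta - 1 - w1) +i* (N%:R * eta - 1 - w2).
    by rewrite !natr_complex; apply: Ceq => /=; ring.
  by rewrite Neta invE /= opprK; apply: inv_part_bound; lra.
have L3 : N%:R * (1 / 9) <= Re E3.
  apply: edge_sum_lower => // k; have /andP[k1 k2] := kb k.
  have -> : - 1 +i* - 1 + N%:R * eta%:C + k%:R * ('i * eta%:C) - (w1 +i* w2) =
      (N%:R * eta - 1 - w1) +i* (k%:R * eta - 1 - w2).
    by rewrite !natr_complex; apply: Ceq => /=; ring.
  by rewrite Neta invE /= [X in _ <= _ / X]addrC; apply: inv_part_bound; lra.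
have L4 : N%:R * (1 / 9) <= - Re E4.
  apply: (@edge_sum_lower (fun z => - Re z)) => [|x y|k] /=.
  - by rewrite oppr0.
  - by rewrite ReD opprD.
  have /andP[k1 k2] := kb k.
  have -> : - 1 +i* - 1 + k%:R * ('i * eta%:C) - (w1 +i* w2) =
      (- 1 - w1) +i* (k%:R * eta - 1 - w2).
    by rewrite !natr_complex; apply: Ceq => /=; ring.
  rewrite invE /= -mulNr -(sqrrN (- 1 - w1)) [X in _ <= _ / X]addrC.
  by apply: inv_part_bound; lra.
have -> : Im (eta%:C * (E1 - E2 + 'i * (E3 - E4))) =
    eta * (Im E1 - Im E2 + (Re E3 - Re E4)).
  by case: E1 E2 E3 E4 {L1 L2 L3 L4} => [? ?] [? ?] [? ?] [? ?] /=; ring.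
have eta0 : 0 <= eta by rewrite divr_ge0.
have : eta * (4 * (N%:R * (1 / 9))) <= eta * (Im E1 - Im E2 + (Re E3 - Re E4)).
  by rewrite ler_wpM2l //; lra.
apply: le_trans.
have -> : eta * (4 * (N%:R * (1 / 9))) = 4 * (1 / 9) * (N%:R * eta) by ring.
by rewrite Neta; lra.
Qed.

Lemma contour_sum_bound (f : R[i] -> R[i]) m B :
  (forall z, dQ z -> normc (f z) <= B) -> normc (contour_sum f m) <= 8 * B.
Proof.
move=> fB; have -> : 8 * B = 4 * 2 * B by ring.
exact: square_sum_bound.
Qed.

Lemma kernel_sum_upper w m : normc w <= 1 / 2 ->
  normc (contour_sum (fun z => (z - w)^-1) m) <= 16.
Proof.
move=> wh; have -> : (16 : R) = 8 * 2 by ring.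
apply: contour_sum_bound => z zQ; rewrite normcV.
have h := dQ_dist zQ wh.
by rewrite -[leRHS]invrK lef_pV2 ?posrE ?invr_gt0 //; lra.
Qed.

Lemma vanishingD (u v : nat -> R[i]) : vanishing u -> vanishing v ->
  vanishing (fun m => u m + v m).
Proof.
move=> hu hv e e0; have e2 : 0 < e / 2 by rewrite divr_gt0.
have [m1 h1] := hu _ e2; have [m2 h2] := hv _ e2.
exists (maxn m1 m2) => m; rewrite geq_max => /andP[/h1 H1 /h2 H2].
by apply: le_trans (le_normcD _ _) _; rewrite [leRHS]splitr lerD.
Qed.

Lemma vanishingZ (a : R[i]) (u : nat -> R[i]) : vanishing u ->
  vanishing (fun m => a * u m).
Proof.
move=> hu e e0; have a1 : 0 < normc a + 1 by rewrite ltr_wpDl ?normc_ge0.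
have [m1 h1] := hu _ (divr_gt0 e0 a1).
exists m1 => m /h1 H; rewrite normcM.
apply: le_trans (ler_wpM2l (normc_ge0 a) H) _.
rewrite mulrA ler_pdivrMr // mulrC ler_wpM2l ?(ltW e0) //.
by rewrite lerDl.
Qed.

Lemma eq_vanishing (u v : nat -> R[i]) : vanishing u ->
  (forall m, v m = u m) -> vanishing v.
Proof. by move=> hu uv e /hu[m0 h]; exists m0 => m /h; rewrite uv. Qed.

(** Write [T n w] for the boundary sums of [g z / (z ^+ n * (z - w))] and [c n]
    for those of [g z / z ^+ n.+1]. Expanding the Cauchy kernel gives
    [T n w = c n + w * T n.+1 w], and for [normc w <= 1 / 2] the sum [T n w] is
    bounded uniformly in [n], in [w] and in the mesh. If every [c n] tends to 0
    with the mesh, then [normc (g w)] is at most [32 * M * normc w ^+ n] for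
    every [n], so that [g w = 0]; otherwise the first [n] for which [c n] does
    not tend to 0 is the order of [g] at 0. *)
Lemma square_dichotomy (g : R[i] -> R[i]) (M : R) :
  (forall p, Q p -> derivable (g : C -> C) p 1) ->
  0 < M -> (forall p, Q p -> normc (g p) <= M) ->
  (forall w, normc w <= 1 / 2 -> g w = 0) \/
  exists n (A B r : R), [/\ 0 < A, 0 < r & forall w, normc w < r ->
    A * normc w ^+ n <= normc (g w) <= B * normc w ^+ n].
Proof.
move=> dg M0 gM.
pose kappa w m := contour_sum (fun z => (z - w)^-1) m.
pose c n m := contour_sum (fun z => g z * (z ^+ n.+1)^-1) m.
pose T n w m := contour_sum (fun z => g z * (z ^+ n)^-1 * (z - w)^-1) m.
have gQ z n : dQ z -> normc (g z * (z ^+ n)^-1) <= M.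
  move=> zQ; rewrite normcM normcV normcX -[leRHS]mulr1.
  apply: ler_pM; rewrite ?invr_ge0 ?exprn_ge0 ?normc_ge0 //.
    by apply: gM; case: zQ.
  have h := exprn_ege1 n (dQ_norm_ge1 zQ).
  by rewrite invf_le1 // (lt_le_trans ltr01).
have Tbound n w m : normc w <= 1 / 2 -> normc (T n w m) <= 16 * M.
  move=> wh; have -> : 16 * M = 8 * (M * 2) by ring.
  apply: contour_sum_bound => z zQ; rewrite normcM.
  apply: ler_pM; rewrite ?normc_ge0 ?gQ // normcV.
  by rewrite -[leRHS]invrK lef_pV2 ?posrE ?invr_gt0 //; have := dQ_dist zQ wh; lra.
have Tstep n w m : normc w <= 1 / 2 -> T n w m = c n m + w * T n.+1 w m.
  move=> wh; rewrite /T /c /contour_sum -square_sumZ -square_sumD.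
  apply: eq_square_sum => // z zQ; have zw := dQ_neq zQ wh.
  have z0 : z != 0 by rewrite -normc_gt0 (lt_le_trans ltr01) // dQ_norm_ge1.
  by rewrite exprS; field; rewrite z0 zw expf_neq0.
have expansion n w : normc w <= 1 / 2 ->
    (forall j, (j < n)%N -> vanishing (c j)) ->
    vanishing (fun m => g w * kappa w m - w ^+ n * T n w m).
  move=> wh; elim: n => [_|n ih hc].
    apply: (eq_vanishing (vanishingZ (- 1) (cauchy_formula dg wh))) => m.
    have -> : T 0 w m = contour_sum (fun z => g z * (z - w)^-1) m.
      by congr contour_sum; apply/funext => z; rewrite expr0 invr1 mulr1.
    by rewrite /kappa; ring.
  have hn : vanishing (c n) by apply: hc.
  have h := ih (fun j jn => hc j (ltnW jn)).
  apply: (eq_vanishing (vanishingD h (vanishingZ (w ^+ n) hn))) => m.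
  by rewrite (Tstep n) // exprSr; ring.
have kle w m : normc w <= 1 / 2 -> normc (g w) / 2 <= normc (g w * kappa w m).
  move=> wh; rewrite normcM ler_wpM2l ?normc_ge0 //.
  by have := kernel_sum_lower m wh; rewrite div1r.
have kge w m : normc w <= 1 / 2 -> normc (g w * kappa w m) <= normc (g w) * 16.
  by move=> wh; rewrite normcM ler_wpM2l ?normc_ge0 // kernel_sum_upper.
have upper n w : normc w <= 1 / 2 -> (forall j, (j < n)%N -> vanishing (c j)) ->
    normc (g w) <= 32 * M * normc w ^+ n.
  move=> wh hc; apply/ler_addgt0Pl => e e0.
  have [m0 /(_ m0 (leqnn _)) h] := expansion n w wh hc _ (divr_gt0 e0 (ltr0n _ 2)).
  have := normc_triB (g w * kappa w m0) (w ^+ n * T n w m0).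
  rewrite [normc (_ ^+ n * _)]normcM normcX.
  have := ler_wpM2l (exprn_ge0 n (normc_ge0 w)) (Tbound n w m0 wh).
  have := kle w m0 wh; lra.
have [allc|] := pselect (forall n, vanishing (c n)).
  left => w wh; apply/eqP; rewrite -normc_eq0 eq_le normc_ge0 andbT.
  apply/ler_addgt0Pl => e e0; rewrite addr0.
  have [n hn] := pow2_small (mulr_ge0 (ler0n R 32) (ltW M0)) e0.
  apply: le_trans (upper n w wh (fun j _ => allc j)) _.
  apply: le_trans _ (ltW hn); rewrite ler_wpM2l ?mulr_ge0 ?(ltW M0) //.
  by rewrite -exprVn lerXn2r ?nnegrE ?normc_ge0 ?invr_ge0 // -div1r.
move=> /existsNP nall; right.
have ex : exists n, `[< ~ vanishing (c n) >].
  by have [n hn] := nall; exists n; apply/asboolP.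
pose n := ex_minn ex.
have [ncn hc] : ~ vanishing (c n) /\ forall j, (j < n)%N -> vanishing (c j).
  rewrite /n; case: ex_minnP => k /asboolP hk kmin; split=> // j jk.
  by apply: contrapT => /asboolP/kmin; rewrite leqNgt jk.
have [dl dl0 hdl] : exists2 dl, 0 < dl &
    forall m0, exists2 m, (m0 <= m)%N & dl < normc (c n m).
  apply: contrapT => H; apply: ncn => e e0; apply: contrapT => H2.
  apply: H; exists e => // m0; apply: contrapT => H3; apply: H2.
  exists m0 => m m0m; rewrite leNgt; apply/negP => em; apply: H3.
  by exists m.
pose r := Num.min (1 / 2) (dl / (32 * M)).
have r0 : 0 < r by rewrite lt_min !divr_gt0 ?mulr_gt0.
exists n, (dl / 32), (32 * M), r; split => //; first by rewrite divr_gt0.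
move=> w; rewrite lt_min => /andP[/ltW wh wdl]; rewrite upper // andbT.
apply/ler_addgt0Pl => e e0.
have [m0 h] := expansion n w wh hc e e0.
have [m /h {}h cm] := hdl m0.
have W0 := exprn_ge0 n (normc_ge0 w).
have T1 : dl / 2 <= normc (T n w m).
  rewrite Tstep //; have := normc_triB (c n m) (- (w * T n.+1 w m)).
  rewrite opprK normcN normcM => h1.
  have h2 := ler_wpM2l (normc_ge0 w) (Tbound n.+1 w m wh).
  have arith (x y q v : R) : x * (32 * M) < dl -> y <= x * (16 * M) ->
      v - y <= q -> dl < v -> dl / 2 <= q by clear => *; lra.
  by apply: arith h2 h1 cm; rewrite -ltr_pdivlMr // mulr_gt0.
have h1 := ler_wpM2l W0 T1.
have := normc_triB (w ^+ n * T n w m) (g w * kappa w m).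
rewrite normcBC [normc (_ ^+ n * _)]normcM normcX => h2.
have h3 := kge w m wh.
have arith (x t G y q : R) : x * (dl / 2) <= x * t -> x * t - G <= q -> q <= e ->
    G <= y * 16 -> dl / 32 * x <= e + y.
  by clear - e0 => *; lra.
exact: arith h1 h2 h h3.
Qed.

(** A small square around [a] is rescaled to the square of center 0 and side 2
    of [square_dichotomy]. *)
Lemma holomorphic_dichotomy (g : R[i] -> R[i]) (a : C) :
  (\forall z \near a, derivable (g : C -> C) z 1) ->
  (\forall z \near a, g z = 0) \/
  exists n (A B : R), 0 < A /\ \forall z \near a,
    A * normc (z - a) ^+ n <= normc (g z) <= B * normc (z - a) ^+ n.
Proof.
move=> dg.
have [r1 r10 h1] := derivable_bounded (nbhs_singleton dg).
have [r2 r20 h2] := (nbhs_complexP _ _).1 dg.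
pose rho := Num.min r1 r2 / 3.
have rho0 : 0 < rho by rewrite divr_gt0 // lt_min r10 r20.
have rhoC : rho%:C != 0 :> R[i] by rewrite -normc_eq0 normc_real gtr0_norm ?gt_eqF.
pose g1 z := g (a + rho%:C * z).
have Qdist z : Q z -> normc (a + rho%:C * z - a) < Num.min r1 r2.
  case: z => z1 z2 [/= /andP[q1 q2] /andP[q3 q4]].
  rewrite addrC addKr normcM normc_real (gtr0_norm rho0).
  apply: le_lt_trans (_ : _ <= rho * 2) _.
    rewrite ler_wpM2l ?(ltW rho0) //; apply: le_trans (normc_le_ReIm _) _ => /=.
    have : `|z1| <= 1 by rewrite ler_norml; lra.
    have : `|z2| <= 1 by rewrite ler_norml; lra.
    lra.
  by move: rho0; rewrite /rho; lra.
have dg1 p : Q p -> derivable (g1 : C -> C) p 1.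
  move=> /Qdist; rewrite lt_min => /andP[_ /h2 h].
  exact: derivable_affine.
have M0 : 0 < normc (g a) + 1 by rewrite ltr_wpDl ?normc_ge0.
have [|zero|[n [A [B [r [A0 r0 hr]]]]]] := square_dichotomy dg1 M0.
- by move=> p /Qdist; rewrite lt_min => /andP[/h1 h _].
- left; apply/nbhs_complexP; exists (rho / 2); first by rewrite divr_gt0.
  move=> z zr; have := zero (rho%:C^-1 * (z - a)).
  rewrite /g1 mulVKf // (addrC a) subrK; apply.
  rewrite normcM normcV normc_real (gtr0_norm rho0) mulrC ler_pdivrMr //.
  by rewrite mulrC mul1r ltW // mulrC.
- right; exists n, (A / rho ^+ n), (B / rho ^+ n).
  split; first by rewrite divr_gt0 // exprn_gt0.
  apply/nbhs_complexP; exists (rho * r); first by rewrite mulr_gt0.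
  move=> z zr; have := hr (rho%:C^-1 * (z - a)).
  rewrite /g1 mulVKf // (addrC a) subrK normcM normcV normc_real (gtr0_norm rho0).
  rewrite [in ltLHS]mulrC ltr_pdivrMr // (mulrC r) => /(_ zr).
  by rewrite exprMn exprVn !mulrA.
Qed.

End LocalOrder.

(** * Orders of meromorphic functions and the identity theorem *)

Section Orders.
Variable R : realType.
Local Notation C := (R[i] : numFieldType).
Implicit Types (f g : R[i] -> R[i]) (a b : R[i]) (k l : int).

(** Two-sided growth bounds determine the order and are multiplicative, which
    is all that the valuation at [a] is used for. *)
Definition has_order f a k := exists A B : R, 0 < A /\
  \forall z \near (a : C)^',
    A * normc (z - a) ^ k <= normc (f z) <= B * normc (z - a) ^ k.

Lemma near_dnbhs_norm a (e : R) : 0 < e ->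
  \forall z \near (a : C)^', 0 < normc (z - a) < e.
Proof.
move=> e0; apply/dnbhs_complexP; exists e => // z ze za.
by rewrite ze normc_gt0 subr_eq0 za.
Qed.

Lemma dnbhs_ex a (P : R[i] -> Prop) : (\forall z \near (a : C)^', P z) ->
  exists z, P z.
Proof. exact: filter_ex. Qed.

Lemma near_dnbhsI a (P Q : R[i] -> Prop) :
  (\forall z \near (a : C)^', P z) -> (\forall z \near (a : C)^', Q z) ->
  \forall z \near (a : C)^', P z /\ Q z.
Proof. exact: filterI. Qed.

Lemma near_dnbhs_imply a (P Q : R[i] -> Prop) :
  (\forall z \near (a : C)^', P z) -> (forall z, P z -> Q z) ->
  \forall z \near (a : C)^', Q z.
Proof. by move=> aP PQ; exact: filterS aP. Qed.

Lemma near_dnbhs a (P : R[i] -> Prop) : (\forall z \near (a : C), P z) ->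
  \forall z \near (a : C)^', P z.
Proof. by apply: filterS => z Pz _. Qed.

Lemma eq_has_order f g a k : (\forall z \near (a : C)^', f z = g z) ->
  has_order f a k -> has_order g a k.
Proof.
move=> fg [A [B [A0 h]]]; exists A, B; split=> //.
by apply: filterS2 fg h => z ->.
Qed.

Lemma has_orderM f g a k l : has_order f a k -> has_order g a l ->
  has_order (fun z => f z * g z) a (k + l).
Proof.
move=> [A [B [A0 h]]] [A' [B' [A'0 h']]].
exists (A * A'), (B * B'); split; first exact: mulr_gt0.
have := near_dnbhs_norm a ltr01; apply: filterS3 h h' => z.
move=> /andP[h1 h2] /andP[h3 h4] /andP[z0 _].
rewrite normcM expfzDr ?gt_eqF // !(mulrACA _ _ (_ ^ k)).
have zk := exprz_ge0 k (ltW z0); have zl := exprz_ge0 l (ltW z0).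
by apply/andP; split; apply: ler_pM; rewrite ?mulr_ge0 ?normc_ge0 ?(ltW A0) ?(ltW A'0).
Qed.

Lemma has_order_unique f a k l : has_order f a k -> has_order f a l -> k = l.
Proof.
suff lekl k' l' : has_order f a k' -> has_order f a l' -> l' <= k'.
  by move=> hk hl; apply/eqP; rewrite eq_le !lekl.
move=> [A [B [A0 h]]] [A' [B' [A'0 h']]]; rewrite leNgt; apply/negP => kl.
have [n ln] : exists n : nat, l' = k' + n.+1%:Z.
  exists (absz (l' - k')).-1; rewrite prednK ?absz_gt0 ?subr_eq0 ?gt_eqF //.
  by rewrite gtz0_abs ?subr_gt0 // subrKC.
have e0 : 0 < Num.min 1 (A / (`|B'| + 1)).
  by rewrite lt_min ltr01 divr_gt0 // ltr_wpDl.
have [z [/andP[h1 _] [/andP[_ h2]]]] :=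
  dnbhs_ex (filterS3 _ (fun z p q r => conj p (conj q r)) h h' (near_dnbhs_norm a e0)).
rewrite lt_min => /and3P[z0 z1 zA].
have := le_trans h1 h2; rewrite ln expfzDr ?gt_eqF // mulrCA.
rewrite [leLHS]mulrC ler_pM2l ?exprz_gt0 // -exprnP exprS => h3.
have zn : normc (z - a) ^+ n <= 1 by rewrite exprn_ile1 // ltW.
have zn0 : 0 <= normc (z - a) ^+ n by rewrite exprn_ge0 // ltW.
have := ler_wpM2r (mulr_ge0 (ltW z0) zn0) (ler_norm B').
have := ler_wpM2l (normr_ge0 B') (ler_wpM2l (ltW z0) zn).
move: zA; rewrite ltr_pdivlMr ?ltr_wpDl //.
move: h3; rewrite mulr1; move: (B' * _) (`|B'| * (_ * _)) (normr_ge0 B') => x y.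
move: (`|B'|) (normc _) z0 => v w z0 *; nra.
Qed.

Lemma meromorphic_dichotomy (f : merofun C) a :
  (\forall z \near (a : C)^', f z = 0) \/ exists k, has_order f a k.
Proof.
have /asboolP/(_ a)[n [g [hg fg]]] := merofun_valP f.
have z0 := near_dnbhs_norm a ltr01.
have nfE : \forall z \near (a : C)^', normc (f z) = normc (g z) / normc (z - a) ^+ n.
  apply: filterS2 z0 fg => z /andP[za _] <-.
  by rewrite normcM normcX mulrAC divff ?mul1r // expf_neq0 // gt_eqF.
have [g0|[m [A [B [A0 h]]]]] := holomorphic_dichotomy hg.
  left; have g0' := near_dnbhs g0.
  apply: filterS2 nfE g0' => z e ez; apply/eqP.
  by rewrite -normc_eq0 e ez normc0 mul0r.
right; exists (m%:Z - n%:Z), A, B; split=> //.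
have h' := near_dnbhs h.
apply: filterS3 z0 nfE h' => z /andP[za _] -> /andP[h1 h2].
rewrite expfzDr ?gt_eqF // -exprnP exprnN !mulrA.
by apply/andP; split; rewrite ler_pM2r ?exprz_gt0.
Qed.

Lemma has_order_neq0 f a k : has_order f a k -> \forall z \near (a : C)^', f z != 0.
Proof.
move=> [A [B [A0 h]]]; have := near_dnbhs_norm a ltr01.
apply: filterS2 h => z /andP[h _] /andP[z0 _].
by rewrite -normc_gt0 (lt_le_trans _ h) // mulr_gt0 // exprz_gt0.
Qed.

Lemma near_dnbhs_punctured_ball (a b : R[i]) (r : R) :
  normc (b - a) < r -> b != a ->
  \forall z \near (b : C)^', normc (z - a) < r /\ z != a.
Proof.
move=> br ba; apply/dnbhs_complexP.
exists (Num.min (r - normc (b - a)) (normc (b - a))).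
  by rewrite lt_min subr_gt0 br normc_gt0 subr_eq0.
move=> z; rewrite lt_min => /andP[z1 z2] _; split.
  by have := le_normcD (z - b) (b - a); rewrite addrA subrK; lra.
by apply: contraTneq z2 => ->; rewrite normcBC ltxx.
Qed.

(** The set of points near which [f] vanishes is open, and its complement is
    open by [meromorphic_dichotomy]; the complex plane is connected. *)
Lemma identity_theorem (f : merofun C) a b :
  (\forall z \near (a : C)^', f z = 0) -> \forall z \near (b : C)^', f z = 0.
Proof.
pose S (p : C) := \forall z \near p^', f z = 0.
have Sopen (p : C) : S p -> \forall q \near p, S q.
  move=> /dnbhs_complexP[r r0 hr]; apply/nbhs_complexP; exists r => // q qr.
  have [->|qp] := eqVneq q p; first by apply/dnbhs_complexP; exists r.
  apply: near_dnbhs_imply (near_dnbhs_punctured_ball qr qp) _.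
  by move=> z [z1 z2]; exact: hr.
have nSopen (p : C) : ~ S p -> \forall q \near p, ~ S q.
  move=> nSp; have [//|[k /has_order_neq0]] := meromorphic_dichotomy f p.
  move=> /dnbhs_complexP[r r0 hr]; apply/nbhs_complexP.
  exists r; first exact: r0.
  move=> q qr; have [->|qp Sq] := eqVneq q p; first exact: nSp.
  have [z [z0 [z1 z2]]] :=
    dnbhs_ex (near_dnbhsI Sq (near_dnbhs_punctured_ball qr qp)).
  by have := hr z z1 z2; rewrite z0 eqxx.
pose gamma (t : R) : R[i] := a + t%:C * (b - a).
have gcont (P : C -> Prop) (t : R) : (\forall q \near (gamma t : C), P q) ->
    \forall s \near t, P (gamma s).
  move=> /nbhs_complexP[r r0 hr].
  have ba0 : 0 < normc (b - a) + 1 by rewrite ltr_wpDl ?normc_ge0.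
  apply/nbhs_ballP; exists (r / (normc (b - a) + 1)); first by rewrite /= divr_gt0.
  move=> s; rewrite /ball /= ltr_pdivlMr // => hs; apply: hr.
  have -> : gamma s - gamma t = (s - t)%:C * (b - a).
    by rewrite /gamma rmorphB; ring.
  rewrite normcM normc_real distrC; apply: le_lt_trans hs.
  by rewrite ler_wpM2l // lerDl.
pose T : set R := [set t | S (gamma t)].
have oT : open T by rewrite openE => t Tt; apply: gcont; exact: Sopen.
have cT : closed T.
  rewrite -openC openE => t Tt.
  exact: (gcont (fun q => ~ S q) t (nSopen _ Tt)).
move=> Sa.
have : T = setT.
  have conn : connected [set: R] by apply/connected_intervalP.
  apply: conn; last 2 first.
  - by exists T => //; rewrite setTI.
  - by exists T => //; rewrite setTI.
  - by exists 0; rewrite /T /= /gamma mul0r addr0.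
move=> TT; have : T 1 by rewrite TT.
by rewrite /T /= /gamma mul1r addrC subrK.
Qed.

End Orders.

(** * Germs at the origin *)

Section MRGerms.
Variable R : realType.
Local Notation C := (R[i] : numFieldType).
Local Notation M := (MR C).
Implicit Types (x y : M).

(** Identities between germs hold on punctured neighbourhoods of 0, where they
    do not depend on the chosen representatives. *)
Definition germ x : R[i] -> R[i] := merofun_val (repr x).

Lemma germ_pi (f : merofun C) :
  \forall z \near (0 : C)^', germ (\pi_M%qT f) z = f z.
Proof.
have : \pi_M%qT (repr (\pi_M%qT f)) = \pi_M%qT f by rewrite reprK.
by move=> /toMR_eq; apply.
Qed.

Lemma germM x y : \forall z \near (0 : C)^', germ (x * y) z = germ x z * germ y z.
Proof.
have := germ_pi (repr x * repr y).
by rewrite toMRM !reprK.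
Qed.

Lemma germD x y : \forall z \near (0 : C)^', germ (x + y) z = germ x z + germ y z.
Proof.
have := germ_pi (repr x + repr y).
by rewrite toMRD !reprK.
Qed.

Lemma germZ (c : R[i]) x : \forall z \near (0 : C)^', germ (c *: x) z = c * germ x z.
Proof.
have := germ_pi (c *: repr x).
by rewrite toMRZ reprK.
Qed.

Lemma germ1 : \forall z \near (0 : C)^', germ 1 z = 1.
Proof. by have := germ_pi 1; rewrite /one /= !piE. Qed.

(** A function vanishing near 0 vanishes near every point by
    [identity_theorem], hence is negligible. *)
Lemma nonzero_has_order x : x != 0 -> exists k, has_order (germ x) 0 k.
Proof.
move=> x0; have [z0|//] := meromorphic_dichotomy (repr x) 0.
case/eqP: x0; rewrite -(reprK x) -[RHS](reprK 0).
apply/toMR_eq => a.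
have zero : \pi_M%qT (0 : merofun C) = 0 by rewrite !piE.
have := (toMR_eq 0 (repr (0 : M))).1; rewrite zero reprK => /(_ erefl a) h.
by apply: filterS2 (identity_theorem a z0) h => z -> <-.
Qed.

Lemma germ_pole x : exists (n : nat) (B : R),
  \forall z \near (0 : C)^', normc (germ x z) * normc z ^+ n <= B.
Proof.
have /asboolP/(_ 0)[n [g [hg fg]]] := merofun_valP (repr x).
have [r r0 hr] := derivable_bounded (nbhs_singleton hg).
exists n, (normc (g 0) + 1); have := near_dnbhs_norm (0 : C) r0.
apply: filterS2 fg => z; rewrite subr0 => e /andP[_ zr].
by rewrite mulrC -normcX -normcM e; apply: hr; rewrite subr0.
Qed.

Lemma id_meromorphic : (id : C -> C) \in @meromorphic C.
Proof.
apply/asboolP => a; exists 0, id; split.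
  by near=> z; exact: derivable_id.
by near=> z; rewrite mul1r.
Unshelve. all: by end_near.
Qed.

Lemma inv_sqr_meromorphic : ((fun z => (z ^+ 2)^-1) : C -> C) \in @meromorphic C.
Proof.
apply/asboolP => a; have [->|a0] := eqVneq a 0.
  exists 2, (cst 1); split.
    by near=> z; exact: derivable_cst.
  apply/dnbhs_complexP; exists 1 => // z _ z0.
  by rewrite subr0 mulfV // expf_neq0.
exists 0, (fun z => (z ^+ 2)^-1); split; last by near=> z; rewrite mul1r.
apply/nbhs_complexP; exists (normc a); first by rewrite normc_gt0.
move=> z za; have z0 : z != 0.
  by apply: contraTneq za => ->; rewrite sub0r normcN ltxx.
have dz : derivable (id ^+ 2 : C -> C) z 1 by apply/derivableX; exact: derivable_id.
have z20 : (id ^+ 2 : C -> C) z != 0 by rewrite exprfctE expf_neq0.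
suff <- : (fun y : C => ((id ^+ 2 : C -> C) y)^-1) = (fun y : C => (y ^+ 2)^-1).
  exact: (derivableV z20 dz).
by apply/funext => t; rewrite exprfctE.
Unshelve. all: by end_near.
Qed.

Definition zvar : M := \pi_M%qT (MeroFun id_meromorphic).
Definition zinv2 : M := \pi_M%qT (MeroFun inv_sqr_meromorphic).

Lemma germ_zvar : \forall z \near (0 : C)^', germ zvar z = z.
Proof. exact: germ_pi. Qed.

Lemma germ_zinv2 : \forall z \near (0 : C)^', germ zinv2 z = (z ^+ 2)^-1.
Proof. exact: germ_pi. Qed.

End MRGerms.

(** * A recursion solved backwards in a complete metrizable group *)

Lemma cvg_binop (T : topologicalType) (op : T -> T -> T) (S : Type)
    (G : set_system S) (u v : S -> T) (b c : T) : Filter G ->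
  continuous (fun p : T * T => op p.1 p.2) ->
  u @ G --> b -> v @ G --> c -> (fun s => op (u s) (v s)) @ G --> op b c.
Proof.
move=> FG opc ub vc.
exact: (cvg_comp (fun s => (u s, v s)) _ (cvg_pair ub vc) (opc (b, c))).
Qed.

Section Recursion.
Variables (R : realType) (K : numFieldType) (A : algType K) (tau : topology A).
Local Notation X := (topologized tau).
Hypothesis metr : metrizable R tau.
Hypothesis calg : complete_topological_algebra tau.

Lemma metric_nbhs : exists d : X -> X -> R,
  [/\ forall x y, d x y = 0 <-> x = y, forall x y, d x y = d y x,
      forall x y z, d x z <= d x y + d y z &
      forall x (U : set X), nbhs x U <->
        exists2 e, 0 < e & [set y | d x y < e] `<=` U].
Proof.
have [d [d0 dC dT dO]] := metr; exists d; split=> // x U; split.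
  rewrite nbhsE => -[V [oV Vx] VU].
  by have [e e0 eV] := (dO V).1 oV x Vx; exists e => // y /eV/VU.
move=> [e e0 eU]; rewrite nbhsE; exists [set y | d x y < e] => //; split.
  apply/dO => y /= yx; exists (e - d x y); first by rewrite subr_gt0.
  by move=> z /=; rewrite ltrBrDl; apply: le_lt_trans; exact: dT.
by rewrite /= (d0 x x).2.
Qed.

Lemma metrizable_hausdorff : hausdorff_space X.
Proof.
have [d [d0 dC dT dN]] := metric_nbhs.
have dge0 x y : 0 <= d x y.
  have := dT x y x; rewrite (d0 x x).2 // (dC y x); lra.
move=> x y xy; apply/d0/eqP; rewrite eq_le dge0 andbT leNgt; apply/negP => h.
have e0 : 0 < d x y / 2 by rewrite divr_gt0.
have ball (z : X) : nbhs z [set u | d z u < d x y / 2].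
  by apply/dN; exists (d x y / 2).
have [z []] := xy _ _ (ball x) (ball y).
by rewrite /= (dC y z) => h1 h2; have := dT x z y; lra.
Qed.

Lemma countable_nbhs (x : X) : exists B : nat -> set X,
  (forall n, nbhs x (B n)) /\ forall U, nbhs x U -> exists n, B n `<=` U.
Proof.
have [d [d0 dC dT dN]] := metric_nbhs.
exists (fun n => [set y | d x y < n.+1%:R^-1]); split=> [n|U /dN[e e0 eU]].
  by apply/dN; exists n.+1%:R^-1; rewrite ?invr_gt0.
exists (Num.bound e^-1) => y /= h; apply: eU; apply: lt_trans h _.
rewrite invf_plt ?posrE //.
apply: lt_le_trans (archi_boundP _) _; first by rewrite invr_ge0 ltW.
by rewrite ler_nat.
Qed.

Let addX : continuous (fun p : X * X => p.1 + p.2).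
Proof. by have [[]] := calg. Qed.

Lemma nbhs0_half (U : set X) : nbhs 0 U -> exists2 V : set X, nbhs 0 V &
  forall x y, V x -> V y -> U (x + y).
Proof.
move=> U0; have := @addX (0, 0) U; rewrite /= addr0 => /(_ U0).
move=> [[V1 V2] /= [h1 h2] h]; exists (V1 `&` V2); first exact: filterI.
by move=> x y [x1 _] [_ y2]; exact: (h (x, y)).
Qed.

Lemma nbhs0_opp (U : set X) : nbhs 0 U -> nbhs 0 [set x | U (- x)].
Proof.
move=> U0; have [[_ sc _] _] := calg.
have := sc (- 1, 0) U; rewrite /= scaler0 => /(_ U0) [[V1 V2] /= [h1 h2] h].
apply: filterS h2 => x V2x; rewrite /= -scaleN1r.
by apply: (h (- 1, x)); split => //=; exact: nbhs_singleton.
Qed.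

Lemma nbhs_translate (a : X) (U : set X) : nbhs a U -> nbhs 0 [set x | U (a + x)].
Proof.
move=> Ua; have := @addX (a, 0) U; rewrite /= addr0 => /(_ Ua).
move=> [[V1 V2] /= [h1 h2] h]; apply: filterS h2 => x V2x.
by apply: (h (a, x)); split => //=; exact: nbhs_singleton.
Qed.

Lemma nbhs_translateN (a : X) (U : set X) : nbhs 0 U -> nbhs a [set x | U (x - a)].
Proof.
move=> U0; have := @addX (a, - a) U; rewrite /= subrr => /(_ U0).
move=> [[V1 V2] /= [h1 h2] h]; apply: filterS h1 => x V1x.
by apply: (h (x, - a)); split => //=; exact: nbhs_singleton.
Qed.

(** Sums of increments taken in [V n.+1], [V n.+2], ... stay in [V n], so such a
    sequence of neighbourhoods does the work of a translation-invariant metric,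
    which the given metric need not be. *)
Lemma halving_base (U0 : set X) : nbhs 0 U0 -> exists V : nat -> set X,
  [/\ V 0 `<=` U0, forall n, nbhs 0 (V n),
      forall n x y, V n.+1 x -> V n.+1 y -> V n (x + y) &
      forall U, nbhs 0 U -> exists n, V n `<=` U].
Proof.
move=> hU0; have [B [B0 BU]] := countable_nbhs 0.
have : forall U : set X, exists V : set X, nbhs 0 U ->
    nbhs 0 V /\ forall x y, V x -> V y -> U (x + y).
  move=> U; have [/nbhs0_half[V V0 VU]|nU] := pselect (nbhs 0 U); first by exists V.
  by exists U.
move=> /choice[half halfP].
pose V := fix V n := if n is n'.+1 then half (V n') `&` B n else U0 `&` B 0.
have V0 n : nbhs 0 (V n).
  elim: n => [|n ih] /=; apply: filterI => //.
  by have [] := halfP _ ih.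
exists V; split => //.
- by move=> x [].
- by move=> n x y [hx _] [hy _]; have [_ h] := halfP _ (V0 n); exact: h.
- move=> U /BU[n BnU]; exists n => x; case: n BnU => [|n] BnU /= [_ Bx]; exact: BnU.
Qed.

Lemma telescoping_limit (V : nat -> set X) (k : nat) (s : nat -> X) :
  (forall n, nbhs 0 (V n)) ->
  (forall n x y, V n.+1 x -> V n.+1 y -> V n (x + y)) ->
  (forall U, nbhs 0 U -> exists n, V n `<=` U) ->
  (forall n, V (k + n).+2 (s n.+1 - s n)) ->
  exists2 x : X, s @ \oo --> x & V k (x - s 0).
Proof.
move=> V0 Vadd Vbase hs.
have Vz n : V n 0 by exact: nbhs_singleton.
have VS n x : V n.+1 x -> V n x by move=> h; rewrite -(addr0 x); exact: Vadd.
have VM m n x : (m <= n)%N -> V n x -> V m x.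
  by move/subnK <-; elim: (n - m)%N => // j ih; move=> h; apply/ih/VS.
have tele m n : V (k + n).+1 (s (n + m)%N - s n).
  elim: m n => [|m ih] n; first by rewrite addn0 subrr.
  rewrite addnS -addSn -(subrK (s n.+1) (s _)) -addrA.
  by apply: Vadd (hs n); have := ih n.+1; rewrite addnS.
have [x sx] : exists x : X, s @ \oo --> x.
  have [_ compl] := calg; apply: compl => U U0.
  have [W W0 WU] := nbhs0_half U0.
  have [n hn] := Vbase _ (filterI W0 (nbhs0_opp W0)).
  pose Y := [set y : X | V n (y - s n)].
  have sY : (s @ \oo) Y.
    exists n => // m /= nm; rewrite /Y /=; apply: (@VM n (k + n).+1).
      by rewrite leqW // leq_addl.
    by rewrite -(subnKC nm); exact: tele.
  exists (Y, Y) => //= -[y1 y2] [/= /hn[h1 _] /hn[_ h2]].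
  have -> : y1 - y2 = (y1 - s n) + - (y2 - s n) by rewrite opprB addrA subrK.
  exact: WU.
exists x => //.
have [m _ /(_ m (leqnn m)) /= hm] := sx _ (nbhs_translateN x (nbhs0_opp (V0 k.+1))).
rewrite -(subrK (s m) x) -addrA; apply: Vadd; first by rewrite -opprB.
by have := tele m 0; rewrite addn0 add0n.
Qed.

Lemma filter_forall_leq (T : Type) (G : set_system T) (P : nat -> set T) n :
  Filter G -> (forall k, G (P k)) -> G [set x | forall k, (k <= n)%N -> P k x].
Proof.
move=> FG GP; elim: n => [|n ih].
  by apply: filterS (GP 0) => x Px k; rewrite leqn0 => /eqP ->.
apply: filterS (filterI ih (GP n.+1)) => x [h1 h2] k.
by rewrite leq_eqVlt => /orP[/eqP -> //|]; rewrite ltnS; exact: h1.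
Qed.

(** The system [p n = F (x n) (p n.+1)] expresses each unknown by the next one,
    hence has no starting point. If the [x n] are chosen one after the other
    close enough to [a], then the truncations
    [F (x k) (F (x k.+1) (... (F (x n) e)))] converge for every [k], because
    replacing the innermost [e = F a e] by [F (x n.+1) e] changes all of those
    with [k <= n.+1] very little. Their limits [p k] solve the system, and stay
    in any prescribed neighbourhood of [e]. *)
Lemma backward_recursion (F : X -> X -> X) (a e : X) (D U : set X) :
  continuous (fun p : X * X => F p.1 p.2) -> F a e = e ->
  (forall W, nbhs a W -> exists2 x, D x & W x) -> nbhs e U ->
  exists x p : nat -> X, forall n, [/\ D (x n), U (p n) & p n = F (x n) (p n.+1)].
Proof.
move=> Fcont Fae Dcl Ue.
have [V [VU V0 Vadd Vbase]] := halving_base (nbhs_translate Ue).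
have foldr_cvg (l : seq X) (T : Type) (G : set_system T) (v : T -> X) c : Filter G ->
    v @ G --> c -> (fun t => foldr F (v t) l) @ G --> foldr F c l.
  move=> FG vc; elim: l => //= b l ih.
  by apply: (cvg_binop (u := fun=> b) FG Fcont) ih; exact: cvg_cst.
have next (l : seq X) : exists x, D x /\ forall k, (k <= size l)%N ->
    V (size l).+2 (foldr F (F x e) (drop k l) - foldr F e (drop k l)).
  suff /Dcl[x Dx hx] : nbhs a [set x | forall k, (k <= size l)%N ->
      V (size l).+2 (foldr F (F x e) (drop k l) - foldr F e (drop k l))].
    by exists x.
  apply: filter_forall_leq => k.
  have c1 : (fun x => F x e) @ a --> F a e.
    by apply: (cvg_binop (u := id) (nbhs_filter a) Fcont) => //; exact: cvg_cst.
  have c2 := foldr_cvg (drop k l) _ _ _ _ (nbhs_filter a) c1.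
  rewrite Fae in c2.
  exact: (c2 _ (nbhs_translateN (foldr F e (drop k l)) (V0 _))).
have [step stepP] := choice next.
pose l := fix l n := if n is n'.+1 then rcons (l n') (step (l n')) else [::].
pose x n := step (l n).
have lE n : l n = map x (iota 0 n).
  by elim: n => // n ih; rewrite -addn1 iotaD map_cat /= -ih cats1 addn1.
pose Q k j := foldr F e (map x (iota k j)).
have Qstep k j : V (k + j).+2 (Q k j.+1 - Q k j).
  have [_ /(_ k)] := stepP (l (k + j)%N).
  rewrite -/(x (k + j)%N) lE size_map size_iota leq_addr => /(_ isT).
  rewrite -map_drop drop_iota addKn add0n.
  by rewrite /Q -[in iota k j.+1]addn1 iotaD map_cat foldr_cat.
have lim k : exists p, Q k @ \oo --> p /\ U p.
  have [p Qp pV] := telescoping_limit V0 Vadd Vbase (Qstep k).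
  exists p; split=> //; suff : U (e + (p - e)) by rewrite addrC subrK.
  apply: VU; have VM n y : V n y -> V 0 y.
    elim: n => // n ih h; apply: ih; rewrite -(addr0 y).
    by apply: Vadd => //; exact: nbhs_singleton.
  exact: VM pV.
have [p pP] := choice lim.
exists x, p => n; split.
- by have [] := stepP (l n).
- by have [] := pP n.
have [Qn _] := pP n; have [Qn1 _] := pP n.+1.
apply: (cvg_unique metrizable_hausdorff
  (F := (fun j => Q n j.+1) @ \oo)).
  by move=> W /Qn[N _ hN]; exists N => // j /= Nj; apply: hN; exact: leqW.
by apply: (cvg_binop (u := fun=> x n) _ Fcont) Qn1; exact: cvg_cst.
Qed.

End Recursion.

(** * Incompatibility of the orders with the topology *)

Section NoTopology.
Variable R : realType.
Local Notation C := (R[i] : numFieldType).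
Local Notation M := (MR C).
Variable tau : topology M.
Local Notation X := (topologized tau).
Hypothesis metr : metrizable R tau.
Hypothesis calg : complete_topological_algebra tau.

Let mulX : continuous (fun p : X * X => p.1 * p.2).
Proof. by have [[]] := calg. Qed.

Let addX : continuous (fun p : X * X => p.1 + p.2).
Proof. by have [[]] := calg. Qed.

Let scale0_nbhs (x a : X) (U : set X) : nbhs a U ->
  exists2 c : R[i], c != 0 & U (a + c *: x).
Proof.
move=> Ua; have [[_ sc _] _] := calg.
have := sc (0, x) _; rewrite /= scale0r => /(_ _ (nbhs_translate calg Ua)).
move=> [[V1 V2] /= [/nbhs_complexP[r r0 hr] h2] h].
exists (r / 2)%:C; first by rewrite -normc_gt0 normc_real gtr0_norm ?divr_gt0.
apply: (h ((r / 2)%:C, x)); split => /=; last exact: nbhs_singleton.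
by apply: hr; rewrite subr0 normc_real gtr0_norm ?divr_gt0 //; lra.
Qed.

(** Solve [p n = 1 + c n * z ^- 2 * p n.+1] with small [c n != 0] and all [p n] in
    the interior of [W]. Since [p n.+1 = z ^ 2 * (p n - 1) / c n], passing from
    [p n] to [p n.+1] lowers the order of the pole at 0 by two; that order is
    finite for [p 0], so that some [p n] is bounded near 0, and then [p n.+1] is
    [O(z ^ 2)]. Adding to it a small multiple of [z] gives order 1. *)
Lemma order_one_dense (W : set X) : nbhs (1 : X) W ->
  exists2 u : X, has_order (germ (u : M)) 0 1 & W u.
Proof.
move=> W1.
pose F (x p : X) : X := 1 + x * p.
pose D : set X := [set x | exists2 c : R[i], c != 0 & x = c *: (zinv2 R : X)].
have Fcont : continuous (fun p : X * X => F p.1 p.2).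
  move=> p; rewrite /F; apply: cvg_binop addX _ (@mulX p).
  exact: cvg_cst.
have D0 U : nbhs (0 : X) U -> exists2 x, D x & U x.
  move=> /(scale0_nbhs (zinv2 R)) [c c0]; rewrite add0r => h.
  by exists (c *: (zinv2 R : X)) => //; exists c.
have F0 : F 0 1 = 1 by rewrite /F mul0r addr0.
have [x [p xpP]] := backward_recursion metr calg Fcont F0 D0
  (nbhs_interior W1).
have rec n : exists2 c : R[i], c != 0 & \forall z \near (0 : C)^',
    germ (p n.+1) z = z ^+ 2 * (germ (p n) z - 1) / c.
  have [[c c0 xE] _ pE] := xpP n; exists c => //.
  have e1 := germD 1 (x n * p n.+1 : M).
  have e2 := germM (x n : M) (p n.+1).
  have e3 := germZ c (zinv2 R).
  have e4 := germ_zinv2 R.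
  have e5 := germ1 R.
  have e6 := near_dnbhs_norm (0 : R[i]) (@ltr01 R).
  have key (z g h : R[i]) : z != 0 -> g = 1 + c * (z ^+ 2)^-1 * h ->
      h = z ^+ 2 * (g - 1) / c by move=> z0 ->; field; rewrite c0 z0.
  have H := near_dnbhsI (near_dnbhsI e1 e2) (near_dnbhsI (near_dnbhsI e3 e4) (near_dnbhsI e5 e6)).
  apply: near_dnbhs_imply H _ => z [[h1 h2] [[h3 h4] [h5]]].
  rewrite subr0 normc_gt0 => /andP[z0 _]; apply: key => //.
  rewrite [in LHS]pE /F; rewrite -h4 -h3 -h5 -xE.
  by rewrite -h2 -h1.
have [n [B hB]] := germ_pole (p 0 : M).
(* The exponent is even, so that steps of two end exactly at 0. *)
have descend j (m : nat) (B' : R) :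
    (\forall z \near (0 : C)^', normc (germ (p j) z) * normc z ^+ (2 * m) <= B') ->
    exists2 B'', 0 < B'' & \forall z \near (0 : C)^',
      normc (germ (p (j + m)%N) z) <= B''.
  elim: m j B' => [|m ih] j B' hj.
    exists (`|B'| + 1); first by rewrite ltr_wpDl.
    apply: filterS hj => z; rewrite expr0 mulr1 addn0 => /le_trans; apply.
    by rewrite (le_trans (ler_norm _)) // lerDl.
  have [c c0 hc] := rec j.
  rewrite addnS -addSn; apply: (ih j.+1 ((B' + 1) / normc c)).
  apply: filterS3 hj hc (near_dnbhs_norm (0 : R[i]) (@ltr01 R)) => z h1 ->.
  rewrite subr0 2!normcM normcX normcV => /andP[z0 z1].
  rewrite mulrAC ler_pM2r ?invr_gt0 ?normc_gt0 //.
  rewrite mulrAC -exprD -mulnS.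
  have zk : normc z ^+ (2 * m.+1) <= 1 by rewrite exprn_ile1 // ltW.
  have zk0 : 0 <= normc z ^+ (2 * m.+1) by rewrite exprn_ge0 // ltW.
  have := ler_wpM2l zk0 (normcB (germ (p j) z) 1); rewrite normc1.
  have arith (s t q : R) : t * s <= B' -> s <= 1 -> s * q <= s * (t + 1) ->
    s * q <= B' + 1 by move=> *; lra.
  exact: arith h1 zk.
have [B' B'0 hB'] : exists2 B', 0 < B' & \forall z \near (0 : C)^',
      normc (germ (p n) z) <= B'.
  apply: (descend 0 n B).
  apply: filterS2 hB (near_dnbhs_norm (0 : R[i]) (@ltr01 R)) => z h1.
  rewrite subr0 => /andP[z0 z1]; apply: le_trans h1.
  rewrite mul2n -addnn exprD mulrA ler_piMr //.
    by rewrite mulr_ge0 ?normc_ge0 // exprn_ge0 // ltW.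
  by rewrite exprn_ile1 // ltW.
have [c c0 hc] := rec n.
have [_ Wp _] := xpP n.+1.
have [e e0 We] := scale0_nbhs (zvar R) Wp.
exists (p n.+1 + e *: (zvar R : X)) => //.
have ne0 : 0 < normc e by rewrite normc_gt0.
have nc0 : 0 < normc c by rewrite normc_gt0.
pose K := (B' + 1) / normc c.
have K0 : 0 < K by apply: divr_gt0 => //; exact: addr_gt0.
exists (normc e / 2), (2 * normc e); split; first by rewrite divr_gt0.
have r0 : 0 < normc e / (2 * K) by apply: divr_gt0 => //; exact: mulr_gt0.
have H := near_dnbhsI (near_dnbhsI (germD (p n.+1) (e *: zvar R)) (germZ e (zvar R)))
  (near_dnbhsI (germ_zvar R) (near_dnbhsI (near_dnbhs_norm (0 : R[i]) r0)
    (near_dnbhsI hB' hc))).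
apply: near_dnbhs_imply H _ => z [[h1 h2] [h3 [/andP[z0 zr] [h4 h5]]]].
move: z0 zr; rewrite subr0 expr1z h1 h2 h3 => z0 zr.
have h6 : normc (germ (p n.+1) z) <= normc z ^+ 2 * K.
  rewrite h5 2!normcM normcX normcV mulrA ler_pM2r ?invr_gt0 //.
  rewrite ler_wpM2l ?exprn_ge0 ?normc_ge0 //.
  by apply: le_trans (normcB _ _) _; rewrite normc1 lerD2r.
have h7 : normc z ^+ 2 * K <= normc z * normc e / 2.
  move: zr; rewrite ltr_pdivlMr ?(mulr_gt0 (ltr0n _ 2) K0) // => zr.
  by have := ler_wpM2l (ltW z0) (ltW zr); rewrite expr2; lra.
have h8 := normc_triB (e * z) (- germ (p n.+1) z).
have h9 := le_normcD (germ (p n.+1) z) (e * z).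
move: h8 h9; rewrite opprK normcN normcM [e * z + _]addrC => h8 h9.
have arith (a b s y t : R) : y <= t -> t <= b * a / 2 -> 0 <= a -> 0 <= b ->
    a * b - y <= s -> s <= y + a * b -> a / 2 * b <= s <= 2 * a * b.
  move=> *; have : 0 <= a * b by exact: mulr_ge0.
  lra.
exact: (arith _ _ _ _ _ h6 h7 (ltW ne0) (ltW z0) h8 h9).
Qed.

(** Solve [p n = u n * p n.+1 ^+ 3] with [u n] of order 1 and [p n != 0]. The
    orders [k n] of the [p n] satisfy [k n = 1 + 3 * k n.+1], that is
    [2 * k n + 1 = 3 * (2 * k n.+1 + 1)], so the odd number [2 * k 0 + 1] is
    divisible by every power of 3. *)
Lemma no_complete_metrizable : False.
Proof.
pose F (u p : X) : X := u * (p * p * p).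
pose D : set X := [set u | has_order (germ (u : M)) 0 1].
have Fcont : continuous (fun p : X * X => F p.1 p.2).
  move=> p; have c2 : (fun q : X * X => q.2) @ p --> p.2 by exact: cvg_snd.
  have c1 : (fun q : X * X => q.1) @ p --> p.1 by exact: cvg_fst.
  exact: (cvg_binop _ mulX c1 (cvg_binop _ mulX (cvg_binop _ mulX c2 c2) c2)).
have F1 : F 1 1 = 1 by rewrite /F !mulr1.
have U1 : nbhs (1 : X) [set x | x != 0].
  apply: open_nbhs_nbhs; split; last by rewrite /= oner_neq0.
  have -> : [set x : X | x != 0] = ~` [set 0].
    by apply/seteqP; split=> x /= /eqP.
  rewrite openC; apply: accessible_closed_set1.
  exact: hausdorff_accessible (metrizable_hausdorff metr).
have [u [p upP]] := backward_recursion metr calg Fcont F1 order_one_dense U1.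
have pE n : p n = u n * (p n.+1 * p n.+1 * p n.+1) by have [] := upP n.
have p0 n : p n != 0 by have [] := upP n.
have [k kP] := choice (fun n => nonzero_has_order (p0 n)).
have kE n : k n = 1 + (k n.+1 + k n.+1 + k n.+1).
  apply: (has_order_unique (kP n)).
  have [uord _ _] := upP n.
  have := has_orderM uord (has_orderM (has_orderM (kP n.+1) (kP n.+1)) (kP n.+1)).
  apply: eq_has_order.
  have e1 := germM (u n : M) (p n.+1 * p n.+1 * p n.+1).
  have e2 := germM (p n.+1 * p n.+1 : M) (p n.+1).
  have e3 := germM (p n.+1 : M) (p n.+1).
  apply: filterS3 e1 e2 e3 => z h1 h2 h3.
  by rewrite (pE n) -h3 -h2; exact/esym/h1.
have dvd n : exists q : int, 2 * k 0%N + 1 = 3 ^+ n * (2 * q + 1).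
  exists (k n); elim: n => [|n ->]; first by rewrite expr0 mul1r.
  by rewrite (kE n) exprS; ring.
pose m := absz (2 * k 0%N + 1).
have [q hq] := dvd m.
have mE : m = (3 ^ m * absz (2 * q + 1)%R)%N by rewrite {1}/m hq abszM abszX.
have q0 : (0 < absz (2 * q + 1)%R)%N by lia.
have := ltn_expl m (isT : 1 < 3)%N.
by rewrite ltnNge [X in (_ <= X)%N]mE leq_pmulr.
Qed.

End NoTopology.

Theorem theoremB9 (R : realType) :
  ~ exists tau : topology (MR R[i]),
      metrizable R tau /\ complete_topological_algebra tau.
Proof. by move=> [tau [metr calg]]; exact: no_complete_metrizable metr calg. Qed.
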